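(* Let $a,b,c\ge0$, $n=a+b+c$, and let $s_A<s_B<s_C$ be positive reals with $s_A/s_B\le1/2$ and $s_B/s_C\le1/2$. Then the Markov chain $\mathcal{X}_t(n)$ on $\Omega_{a,b,c}$ satisfies $t(\mathcal{X}_t(n))\le O(n^4)$.
   Context: $\Omega_{a,b,c}$ is the set of all words of length $n$ (positions $1,\dots,n$) with $a$ letters $A$, $b$ letters $B$, $c$ letters $C$; the ''strength'' of a letter $P$ is $s_P$, and ''increasing order of strength'' of two letters at positions $i<j$ means the weaker one is at $i$ and the stronger at $j$. The chain $\mathcal{X}_t(n)$: from $\sigma$, choose a pair $1\le i<j\le n$ uniformly at random. (Jump) If $\{\sigma(i),\sigma(j)\}=\{A,C\}$ and $\sigma(i+1),\dots,\sigma(j-1)$ are all $B$, put $\sigma(i),\sigma(j)$ in increasing order of strength with probability $(s_C/s_A)^{j-i}/(1+(s_C/s_A)^{j-i})$ and in decreasing order with probability $1/(1+(s_C/s_A)^{j-i})$. (Hop) If $P\in\{A,C\}$ and either $\sigma(i),\dots,\sigma(j-1)$ are all $B$ and $\sigma(j)=P$, or $\sigma(i)=P$ and $\sigma(i+1),\dots,\sigma(j)$ are all $B$, put $\sigma(i),\sigma(j)$ (one $P$, one $B$) in increasing order of strength with probability $r/(1+r)$ and in decreasing order with probability $1/(1+r)$, where $r=(s_B/s_A)^{j-i}$ if $P=A$ and $r=(s_C/s_B)^{j-i}$ if $P=C$. Otherwise do nothing. Its stationary distribution is $\pi(\sigma)\propto\prod_{i=1}^n s_{\sigma(i)}^{\,i}$.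 The mixing time $t(\mathcal{M})$ is the least $t$ with $\max_x\|P^t(x,\cdot)-\pi\|_{TV}\le1/4$. *)

(* Defs.v *)
From HB Require Import structures.
From mathcomp Require Import all_boot all_order all_algebra.
From mathcomp Require Import perm reals.

Set Implicit Arguments.
Unset Strict Implicit.
Unset Printing Implicit Defensive.

Import Order.TTheory GRing.Theory Num.Theory.
Local Open Scope ring_scope.

Section FiniteMarkovChain.
Variables (R : realType) (T : finType).
Implicit Types (P : T -> T -> R) (mu nu pi : T -> R).

Fixpoint kernel_pow P (t : nat) (x y : T) : R :=
  if t is t'.+1 then \sum_z P x z * kernel_pow P t' z y else (x == y)%:R.

Definition tv_dist mu nu : R := (\sum_x `|mu x - nu x|) / 2.

Definition mixed P pi (t : nat) : Prop :=
  \big[Num.max/0]_x tv_dist (kernel_pow P t x) pi <= 1 / 4.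

(* Relational, so that no default value is attached to a chain that never
   mixes. *)
Definition is_mixing_time P pi (t : nat) : Prop :=
  mixed P pi t /\ forall u : nat, mixed P pi u -> (t <= u)%N.

End FiniteMarkovChain.

Inductive letter := LA | LB | LC.

Definition ord_of_letter (l : letter) : 'I_3 :=
  match l with LA => inord 0 | LB => inord 1 | LC => inord 2 end.

Definition letter_of_ord (i : 'I_3) : letter :=
  match val i with 0 => LA | 1 => LB | _ => LC end%N.

Lemma ord_of_letterK : cancel ord_of_letter letter_of_ord.
Proof. by case; rewrite /letter_of_ord /= inordK. Qed.

HB.instance Definition _ := Finite.copy letter (can_type ord_of_letterK).

(* Positions are numbered from 0: [i : 'I_n] is position [i.+1] of the word. *)
Definition word (n : nat) := {ffun 'I_n -> letter}.

Definition has_content (a b c n : nat) (w : word n) : bool :=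
  [&& #|[set i | w i == LA]| == a, #|[set i | w i == LB]| == b
    & #|[set i | w i == LC]| == c].

Definition Omega (a b c : nat) := {w : word (a + b + c)%N | has_content a b c w}.

Section Chain.
Variables (R : realType) (s : letter -> R) (n : nat).
Implicit Types (w v : word n) (i j k : 'I_n).

Definition swap w i j : word n := [ffun k => w (tperm i j k)].

Definition put_increasing w i j : word n :=
  if s (w i) < s (w j) then w else swap w i j.

Definition put_decreasing w i j : word n :=
  if s (w i) < s (w j) then swap w i j else w.

Definition is_jump w i j : bool :=
  [&& ((w i == LA) && (w j == LC)) || ((w i == LC) && (w j == LA))
    & [forall k : 'I_n, (i < k < j)%N ==> (w k == LB)]].

Definition is_hop (p : letter) w i j : bool :=
  ([forall k : 'I_n, (i <= k < j)%N ==> (w k == LB)] && (w j == p))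
  || ((w i == p) && [forall k : 'I_n, (i < k <= j)%N ==> (w k == LB)]).

(* The odds of the increasing order against the decreasing one when the pair
   [i < j] is chosen; [None] when the chain does nothing. The three tests are
   mutually exclusive. *)
Definition move_odds w i j : option R :=
  if is_jump w i j then Some ((s LC / s LA) ^+ (j - i))
  else if is_hop LA w i j then Some ((s LB / s LA) ^+ (j - i))
  else if is_hop LC w i j then Some ((s LC / s LB) ^+ (j - i))
  else None.

Definition pair_kernel i j w v : R :=
  if move_odds w i j is Some r then
    r / (1 + r) * (v == put_increasing w i j)%:R
    + 1 / (1 + r) * (v == put_decreasing w i j)%:R
  else (v == w)%:R.

(* With fewer than two positions there is no pair to choose and the chain stays
   put. *)
Definition word_kernel w v : R :=
  if (n < 2)%N then (v == w)%:R
  else (\sum_(i : 'I_n) \sum_(j : 'I_n | (i < j)%N) pair_kernel i j w v) / 'C(n, 2)%:R.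

Definition weight w : R := \prod_i s (w i) ^+ i.+1.

End Chain.

(* Moves permute letters, so the kernel on words restricts to [Omega a b c]. *)
Definition chainX (R : realType) (s : letter -> R) (a b c : nat)
    (x y : Omega a b c) : R :=
  word_kernel s (val x) (val y).

Definition stationary (R : realType) (s : letter -> R) (a b c : nat)
    (x : Omega a b c) : R :=
  weight s (val x) / \sum_(y : Omega a b c) weight s (val y).

(* Main.v *)
(* Write p for the number of A's preceded by some B, q for the number of C's
   followed by some B and I for the number of pairs C...A.  A move changes each
   of them by at most one, and the three vanish together only on the sorted word.
   - Steps A-to-C and C-to-A alternate among the A's and C's, so jumps make I
     drift downwards as soon as I > 0.
   - Only the run of B's that starts at the first B matters for p.  The A just
     before it may enter it, at total rate at most sum_e 1/(1+2^e).  If the run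
     is followed by an A, that A leaves it at a rate exceeding this by a factor
     5/4; if it is followed by a C, then p <= I.  Dually for q.
   Hence F = (9/8)^p + (9/8)^q + 16 (9/8)^I has drift at most 16 - F/135, and the
   concave correction M (1 - 16^-(p+q+I)), which is dominated by the one good
   move available near the sorted word, gives a function W >= 1 with drift at
   most - eps W off the sorted word x0, per unit of time in which each of the
   'C(n, 2) pairs is chosen once.
   For a reversible chain this yields both a Poincare inequality for functions
   vanishing at x0, hence L2 mixing from x0 because P is an average of
   projections, and a geometric hitting time of x0.  Since log W = O(n^2), all
   words mix in O(n^2 * n^2) steps. *)

Require Import Defs.
From mathcomp Require Import all_boot all_order all_algebra reals.
From mathcomp Require Import perm ring lra zify.

Set Implicit Arguments.
Unset Strict Implicit.
Unset Printing Implicit Defensive.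

Import Order.TTheory GRing.Theory Num.Theory.
Local Open Scope ring_scope.

(** * Mixing of a reversible chain from a drift towards one state *)

Section ReversibleChain.
Variables (R : realType) (T : finType) (P : T -> T -> R) (pi : T -> R).
Hypothesis P_ge0 : forall x y, 0 <= P x y.
Hypothesis P_sum : forall x, \sum_y P x y = 1.
Hypothesis pi_gt0 : forall x, 0 < pi x.
Hypothesis pi_sum : \sum_x pi x = 1.
Hypothesis P_rev : forall x y, pi x * P x y = pi y * P y x.

Definition avg (g : T -> R) (x : T) : R := \sum_y P x y * g y.

Lemma expectation_avg (g : T -> R) :
  \sum_x pi x * avg g x = \sum_x pi x * g x.
Proof.
transitivity (\sum_x \sum_y pi y * P y x * g y).
  by apply: eq_bigr => x _; rewrite mulr_sumr; apply: eq_bigr => y _;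
     rewrite mulrA P_rev.
rewrite exchange_big; apply: eq_bigr => y _ /=.
by rewrite -mulr_suml -mulr_sumr P_sum mulr1.
Qed.

Lemma kernel_powSr t x y :
  kernel_pow P t.+1 x y = \sum_z kernel_pow P t x z * P z y.
Proof.
elim: t x => [|t IHt] x.
  rewrite /= (bigD1 y) //= eqxx mulr1 big1 ?addr0; last first.
    by move=> z /negPf ->; rewrite mulr0.
  rewrite (bigD1 x) //= eqxx mul1r big1 ?addr0 // => z.
  by rewrite eq_sym => /negPf ->; rewrite mul0r.
transitivity (\sum_z P x z * kernel_pow P t.+1 z y); first by [].
under eq_bigr do rewrite IHt mulr_sumr.
rewrite exchange_big; apply: eq_bigr => z _ /=.
by rewrite mulr_suml; apply: eq_bigr => u _; rewrite mulrA.
Qed.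

Lemma kernel_pow_rev t x y :
  pi x * kernel_pow P t x y = pi y * kernel_pow P t y x.
Proof.
elim: t x y => [|t IHt] x y.
  by rewrite /=; have [->|nxy] := eqVneq x y; rewrite ?mulr0.
rewrite kernel_powSr /= !mulr_sumr.
by apply: eq_bigr => z _; rewrite [in RHS]mulrA [in RHS]P_rev [in LHS]mulrA IHt mulrAC.
Qed.

Lemma kernel_pow_ge0 t x y : 0 <= kernel_pow P t x y.
Proof.
elim: t x => [|t IHt] x /=; first by rewrite ler0n.
by apply: sumr_ge0 => z _; rewrite mulr_ge0.
Qed.

Lemma kernel_pow_sum t x : \sum_y kernel_pow P t x y = 1.
Proof.
elim: t x => [|t IHt] x /=.
  by rewrite (bigD1 x) //= eqxx big1 ?addr0 // => y; rewrite eq_sym => /negPf ->.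
rewrite exchange_big -[RHS](P_sum x); apply: eq_bigr => z _ /=.
by rewrite -mulr_sumr IHt mulr1.
Qed.

(** Twice the total variation distance to [pi]. *)
Let dist t x : R := \sum_y `|kernel_pow P t x y - pi y|.

Lemma dist_le2 t x : dist t x <= 2.
Proof.
apply: (@le_trans _ _ (\sum_y (kernel_pow P t x y + pi y))).
  apply: ler_sum => y _; rewrite (le_trans (ler_normB _ _)) //.
  by rewrite ger0_norm ?kernel_pow_ge0 // ger0_norm // ltW.
by rewrite big_split /= kernel_pow_sum pi_sum.
Qed.

(** Conditioning on the first step writes the signed measure at time [t.+1] as a mixture of those at
    time [t]; the triangle inequality concludes. *)
Lemma distS t x : dist t.+1 x <= avg (dist t) x.
Proof.
have E y : kernel_pow P t.+1 x y - pi y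
         = \sum_z P x z * (kernel_pow P t z y - pi y).
  under [RHS]eq_bigr do rewrite mulrBr.
  by rewrite sumrB -mulr_suml P_sum mul1r.
rewrite /dist; under eq_bigr do rewrite E.
rewrite /avg; under [leRHS]eq_bigr do rewrite mulr_sumr.
rewrite exchange_big; apply: ler_sum => y _ /=.
apply: (le_trans (ler_norm_sum _ _ _)); apply: ler_sum => z _.
by rewrite normrM (ger0_norm (P_ge0 _ _)).
Qed.

Section Drift.
Variables (W : T -> R) (x0 : T) (gamma c : R).
Hypothesis gamma_gt0 : 0 < gamma.
Hypothesis gamma_le1 : gamma <= 1.
Hypothesis W_ge1 : forall x, 1 <= W x.
Hypothesis W_drift : forall x, x != x0 -> avg W x <= (1 - gamma) * W x.
Hypothesis W_drift0 : avg W x0 <= (1 - gamma) * W x0 + gamma * c.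
(** In L2(pi) this reads P^2 <= P: the self-adjoint operator P has its spectrum in [0, 1], so a
    bound on the quadratic form of P bounds the norm of its image. *)
Hypothesis P_psd :
  forall g, \sum_x pi x * avg g x ^+ 2 <= \sum_x pi x * (g x * avg g x).

(** Integrating the drift against the stationary [pi] leaves gamma E(W) <= gamma c pi(x0), while
    E(W) >= 1. *)
Lemma inv_pi_ground : (pi x0)^-1 <= c.
Proof.
have H : \sum_x pi x * W x <= (1 - gamma) * \sum_x pi x * W x + pi x0 * (gamma * c).
  rewrite -{1}expectation_avg (bigD1 x0) //= [X in _ <= _ * X + _](bigD1 x0) //=.
  have H0 : pi x0 * avg W x0 <= pi x0 * ((1 - gamma) * W x0 + gamma * c).
    by rewrite ler_pM2l.
  have : \sum_(x | x != x0) pi x * avg W x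
         <= (1 - gamma) * \sum_(x | x != x0) pi x * W x.
    by rewrite mulr_sumr; apply: ler_sum => x /W_drift Hx; rewrite mulrCA ler_pM2l.
  move: (\sum_(x | _) _) (\sum_(x | _) _) => S1 S2. lra.
have H1 : 1 <= \sum_x pi x * W x.
  rewrite -pi_sum; apply: ler_sum => x _.
  by rewrite ler_peMr // ltW.
have H2 : gamma * \sum_x pi x * W x <= gamma * (pi x0 * c) by lra.
rewrite ler_pM2l // in H2.
by rewrite -[_^-1]mulr1 ler_pdivrMl //; apply: le_trans H2.
Qed.

(* Symmetrising <h, Ph>, AM-GM gives
   2 h(x) h(y) <= h(x)^2 W(y)/W(x) + h(y)^2 W(x)/W(y). *)
Lemma poincare_ground (h : T -> R) : h x0 = 0 ->
  \sum_x pi x * (h x * avg h x) <= (1 - gamma) * \sum_x pi x * h x ^+ 2.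
Proof.
move=> h0.
have W_gt0 x : 0 < W x by apply: lt_le_trans (W_ge1 x).
have E : \sum_x pi x * (h x ^+ 2 * (avg W x / W x))
       = \sum_x \sum_y pi x * P x y * (h x ^+ 2 * (W y / W x)).
  apply: eq_bigr => x _; rewrite /avg mulr_suml !mulr_sumr.
  by apply: eq_bigr => y _; ring.
apply: (@le_trans _ _ (\sum_x pi x * (h x ^+ 2 * (avg W x / W x)))); last first.
  rewrite mulr_sumr; apply: ler_sum => x _.
  have [->|nx] := eqVneq x x0; first by rewrite h0 expr0n /= mul0r !mulr0.
  rewrite [leRHS]mulrCA ler_pM2l // mulrC ler_wpM2r ?sqr_ge0 //.
  by rewrite ler_pdivrMr // W_drift.
have Esym : \sum_x \sum_y pi x * P x y * (h x ^+ 2 * (W y / W x))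
   = \sum_x \sum_y pi x * P x y * (h y ^+ 2 * (W x / W y)).
  by rewrite exchange_big; apply: eq_bigr => x _; apply: eq_bigr => y _;
     rewrite P_rev.
have : 2 * (\sum_x pi x * (h x * avg h x)) <=
       2 * (\sum_x pi x * (h x ^+ 2 * (avg W x / W x))); last by lra.
rewrite E [leRHS]mulr_natl [leRHS]mulr2n {2}Esym -big_split /= mulr_sumr.
apply: ler_sum => x _; rewrite -big_split /= /avg !mulr_sumr.
apply: ler_sum => y _; rewrite -mulrDr.
have -> : 2 * (pi x * (h x * (P x y * h y)))
  = pi x * P x y * (2 * (h x * h y)) by ring.
apply: ler_wpM2l; first by rewrite mulr_ge0 // ltW.
set a := W y / W x; have a_gt0 : 0 < a by rewrite divr_gt0.
have -> : W x / W y = a^-1 by rewrite invf_div.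
have : 0 <= a^-1 * (h y - a * h x) ^+ 2 by rewrite mulr_ge0 ?sqr_ge0 ?invr_ge0 ?ltW.
have -> : a^-1 * (h y - a * h x) ^+ 2
  = h x ^+ 2 * a + h y ^+ 2 * a^-1 - 2 * (h x * h y).
  by field; rewrite gt_eqF.
lra.
Qed.

(** Subtracting a = f(x0) brings [poincare_ground] into play. As f has mean zero, the shift adds a^2
    to the quadratic form and to the square norm alike, and the factor 1 - gamma makes this
    favourable. *)
Lemma variance_contraction (f : T -> R) : \sum_x pi x * f x = 0 ->
  \sum_x pi x * avg f x ^+ 2 <= (1 - gamma) * \sum_x pi x * f x ^+ 2.
Proof.
move=> f0; apply: (le_trans (P_psd f)).
set a := f x0.
have avgB x : avg (fun y => f y - a) x = avg f x - a.
  rewrite /avg; under eq_bigr do rewrite mulrBr.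
  by rewrite sumrB -mulr_suml P_sum mul1r.
have := @poincare_ground (fun y => f y - a) (subrr _).
under eq_bigr do rewrite avgB.
have -> : \sum_x pi x * ((f x - a) * (avg f x - a))
  = \sum_x pi x * (f x * avg f x) + a ^+ 2.
  have E x : pi x * ((f x - a) * (avg f x - a))
    = pi x * (f x * avg f x) + (pi x * a ^+ 2 - a * (pi x * f x) - a * (pi x * avg f x)).
    by ring.
  rewrite (eq_bigr _ (fun x _ => E x)) big_split /= !sumrB -mulr_suml -!mulr_sumr.
  by rewrite expectation_avg f0 pi_sum; ring.
have -> : \sum_x pi x * (f x - a) ^+ 2 = \sum_x pi x * f x ^+ 2 + a ^+ 2.
  have E x : pi x * (f x - a) ^+ 2
    = pi x * f x ^+ 2 + (pi x * a ^+ 2 - a * 2 * (pi x * f x)) by ring.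
  rewrite (eq_bigr _ (fun x _ => E x)) big_split /= !sumrB -mulr_suml -!mulr_sumr.
  by rewrite f0 pi_sum; ring.
rewrite mulrDr; have : 0 <= gamma * a ^+ 2 by rewrite mulr_ge0 ?sqr_ge0 ?ltW.
lra.
Qed.

(** By reversibility, the density with respect to [pi] of the law at time t started from [x0], minus
    1. With [x] as the starting point, one more step of time is one application of [avg]. *)
Let density t x : R := kernel_pow P t x x0 / pi x0 - 1.

Lemma density_mean t : \sum_x pi x * density t x = 0.
Proof.
under eq_bigr do rewrite mulrBr mulr1 mulrA kernel_pow_rev mulrAC mulfV ?gt_eqF ?mul1r //.
by rewrite sumrB kernel_pow_sum pi_sum subrr.
Qed.

(** At time 0 the variance is 1/pi(x0) - 1 <= c, and each step contracts it by
    [variance_contraction]. *)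
Lemma density_variance t :
  \sum_x pi x * density t x ^+ 2 <= (1 - gamma) ^+ t * c.
Proof.
have p0 : pi x0 != 0 by rewrite gt_eqF.
elim: t => [|t IHt].
  rewrite expr0 mul1r; apply: le_trans inv_pi_ground.
  have E x : pi x * density 0 x ^+ 2
    = pi x * density 0 x * ((x == x0)%:R / pi x0) - pi x * density 0 x.
    by rewrite /density /=; ring.
  rewrite (eq_bigr _ (fun x _ => E x)) sumrB density_mean subr0.
  rewrite (bigD1 x0) //= big1 ?addr0; last first.
    by move=> x /negPf ->; rewrite mul0r mulr0.
  rewrite /density /= eqxx.
  have -> : pi x0 * (true%:R / pi x0 - 1) * (true%:R / pi x0) = (pi x0)^-1 - 1.
    by rewrite mul1r; field.
  by rewrite gerBl.
have g0 : 0 <= 1 - gamma by rewrite subr_ge0.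
rewrite exprS -mulrA; apply: le_trans (ler_wpM2l g0 IHt).
apply: le_trans (variance_contraction (density_mean t)).
apply: ler_sum => x _; rewrite ler_wpM2l ?(ltW (pi_gt0 x)) // le_eqVlt; apply/orP; left.
apply/eqP; congr (_ ^+ 2); rewrite /density /= /avg.
under [RHS]eq_bigr do rewrite mulrBr mulr1 mulrA.
by rewrite sumrB P_sum -mulr_suml.
Qed.

Lemma dist_ground t : dist t x0 ^+ 2 <= (1 - gamma) ^+ t * c.
Proof.
apply: le_trans (density_variance t).
have -> : dist t x0 = \sum_x pi x * `|density t x|.
  apply: eq_bigr => x _; rewrite -{2}(ger0_norm (ltW (pi_gt0 x))) -normrM.
  rewrite /density mulrBr mulr1 mulrA kernel_pow_rev mulrAC mulfV ?mul1r //.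
  by rewrite gt_eqF.
set m := \sum_x _.
(* Cauchy-Schwarz, in the form that the variance of the absolute value of the density is
   nonnegative. *)
have : 0 <= \sum_x pi x * (`|density t x| - m) ^+ 2.
  by apply: sumr_ge0 => x _; rewrite mulr_ge0 ?sqr_ge0 // ltW.
have E x : pi x * (`|density t x| - m) ^+ 2
  = pi x * density t x ^+ 2 + (pi x * m ^+ 2 - m * 2 * (pi x * `|density t x|)).
  by rewrite sqrrB real_normK ?num_real //; ring.
rewrite (eq_bigr _ (fun x _ => E x)) big_split /= sumrB -mulr_suml -mulr_sumr pi_sum -/m.
lra.
Qed.

(** Here (1 - gamma)^s W(x) bounds the probability of missing [x0] for s steps, in which case the
    distance is at most 2. Once at [x0], between t and t + s steps remain, which is why the
    hypothesis covers every later time. Induction on the first step replaces a stopping time. *)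
Lemma dist_hitting t eps s x : 0 <= eps ->
  (forall u, (t <= u)%N -> dist u x0 <= eps) ->
  dist (t + s) x <= eps + 2 * ((1 - gamma) ^+ s * W x).
Proof.
move=> eps_ge0 Heps; have g0 : 0 <= 1 - gamma by rewrite subr_ge0.
elim: s x => [|s IHs] x.
  have := dist_le2 (t + 0) x; have := W_ge1 x; rewrite expr0; lra.
have [->|nx] := eqVneq x x0.
  have := Heps (t + s.+1)%N (leq_addr _ _).
  have : 0 <= (1 - gamma) ^+ s.+1 * W x0.
    by rewrite mulr_ge0 ?exprn_ge0 // (le_trans ler01).
  lra.
rewrite addnS; apply: (le_trans (distS _ _)).
apply: (@le_trans _ _ (\sum_y P x y * (eps + 2 * ((1 - gamma) ^+ s * W y)))).
  by apply: ler_sum => y _; rewrite ler_wpM2l.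
under eq_bigr => y _ do rewrite mulrDr !(mulrCA (P x y)).
rewrite big_split /= -mulr_suml P_sum mul1r -!mulr_sumr lerD2l ler_pM2l //.
by rewrite exprSr -mulrA ler_wpM2l ?exprn_ge0 // W_drift.
Qed.

(** By induction (1 - gamma)^k (1 + k gamma) <= 1, and the second factor is at least 2 at k = m. *)
Lemma bernoulli_decay m : (m%:R * gamma >= 1) -> (1 - gamma) ^+ m <= 2^-1.
Proof.
move=> Hm; have B : forall k, (1 - gamma) ^+ k * (1 + k%:R * gamma) <= 1.
  elim=> [|k IHk]; first by rewrite expr0 mul0r addr0 mulr1.
  apply: le_trans IHk; rewrite exprSr -mulrA; apply: ler_wpM2l.
    by apply: exprn_ge0; rewrite subr_ge0.
  rewrite -natr1; have : 0 <= (k%:R + 1) * gamma ^+ 2 by rewrite mulr_ge0 ?sqr_ge0 // addr_ge0.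
  lra.
have := B m; have : 0 <= (1 - gamma) ^+ m by apply: exprn_ge0; rewrite subr_ge0.
move: (_ ^+ m) => u Hu HB.
have : u * 1 <= u * (m%:R * gamma) by rewrite ler_wpM2l.
lra.
Qed.

(** Every q steps halve the error. The additional 4 brings the squared distance from [x0] down to
    1/16, the additional 3 brings the hitting term down to 2/8; the distance is then at most 1/4 +
    1/4, which is twice the required total variation. *)
Lemma mixed_drift q k1 k2 :
  1 <= q%:R * gamma -> c <= 2 ^+ k1 -> (forall x, W x <= 2 ^+ k2) ->
  mixed P pi (q * (k1 + 4) + q * (k2 + 3)).
Proof.
move=> Hq Hc HW; have Hq2 := bernoulli_decay Hq.
have g0 : 0 <= 1 - gamma by rewrite subr_ge0.
have half k : (1 - gamma) ^+ (q * k) <= (2 ^+ k)^-1.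
  rewrite exprM -exprVn lerXn2r ?nnegrE ?invr_ge0 ?exprn_ge0 //.
have Heps u : (q * (k1 + 4) <= u)%N -> dist u x0 <= 4^-1.
  move=> Hu; rewrite -(@ler_pXn2r _ 2) ?nnegrE ?sumr_ge0 ?invr_ge0 //.
  apply: (le_trans (dist_ground u)).
  have c0 : 0 <= c by apply: le_trans inv_pi_ground; rewrite invr_ge0 ltW.
  apply: (@le_trans _ _ ((2 ^+ (k1 + 4))^-1 * 2 ^+ k1)).
    apply: ler_pM => //; first exact: exprn_ge0.
    by apply: le_trans (half _); apply: ler_wiXn2l => //; rewrite gerBl ltW.
  rewrite exprD invfM mulrAC mulVf ?mul1r ?expf_neq0 ?pnatr_eq0 //.
  have -> : 2 ^+ 4 = 16 :> R by ring.
  have -> : 4^-1 ^+ 2 = 16^-1 :> R by rewrite exprVn; congr (_ ^-1); ring.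
  by [].
have H4 : 0 <= 4^-1 :> R by rewrite invr_ge0.
rewrite /mixed; apply: bigmax_le => [|x _]; first by lra.
rewrite /tv_dist -/(dist _ x).
have := dist_hitting (q * (k2 + 3)) x H4 Heps.
have : (1 - gamma) ^+ (q * (k2 + 3)) * W x <= (2 ^+ (k2 + 3))^-1 * 2 ^+ k2.
  by apply: ler_pM; rewrite ?exprn_ge0 // (le_trans ler01).
rewrite exprD invfM mulrAC mulVf ?mul1r ?expf_neq0 ?pnatr_eq0 //.
have -> : (2 ^+ 3)^-1 = 1 / 8 :> R by rewrite mul1r; congr (_ ^-1); ring.
lra.
Qed.

End Drift.
End ReversibleChain.

(** * Statistics of words *)

Definition rank (x : letter) : nat :=
  match x with LA => 0 | LB => 1 | LC => 2 end.

(** Equality of letters was transported through [inord], which does not reduce; comparison of ranks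
    does. *)
Lemma letter_eq x y : (x == y) = (rank x == rank y).
Proof. by apply/eqP/eqP => [->//|]; case: x; case: y. Qed.

Definition flip (x : letter) : letter :=
  match x with LA => LC | LB => LB | LC => LA end.

(** Reversing positions and strengths together preserves sortedness; it exchanges [dispA] with
    [dispC] and fixes [invCA], so each fact about C's comes from one about A's. *)
Definition dual (l : seq letter) : seq letter := rev (map flip l).

(** [dispA], [dispC] and [invCA] are the p, q and I of the opening overview. *)
Fixpoint dispA (l : seq letter) : nat :=
  if l is x :: t then if x == LB then count_mem LA t else dispA t else 0.

Definition dispC (l : seq letter) : nat := dispA (dual l).

Fixpoint invCA (l : seq letter) : nat :=
  if l is x :: t then ((if x == LC then count_mem LA t else 0) + invCA t)%N else 0.

Definition seqswap (l : seq letter) (i j : nat) : seq letter :=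
  set_nth LA (set_nth LA l i (nth LA l j)) j (nth LA l i).

Lemma flipK : involutive flip. Proof. by case. Qed.

Lemma dualK : involutive dual.
Proof. by move=> l; rewrite /dual map_rev revK (mapK flipK). Qed.

Lemma size_dual l : size (dual l) = size l.
Proof. by rewrite size_rev size_map. Qed.

Lemma dual_cat l1 l2 : dual (l1 ++ l2) = dual l2 ++ dual l1.
Proof. by rewrite /dual map_cat rev_cat. Qed.

Lemma dual_pair u x m y v :
  dual (u ++ x :: m ++ y :: v) = dual v ++ flip y :: dual m ++ flip x :: dual u.
Proof.
rewrite -cat1s -[y :: v]cat1s !dual_cat -!catA.
by rewrite -[flip y :: _]cat1s -[flip x :: _]cat1s.
Qed.

Lemma all_isB_dual m : all (pred1 LB) (dual m) = all (pred1 LB) m.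
Proof.
rewrite all_rev all_map; apply: eq_all => x /=.
by rewrite -[LB in LHS]/(flip LB) (inj_eq (inv_inj flipK)).
Qed.

Lemma dispA_cat u t :
  dispA (u ++ t) = if LB \in u then (dispA u + count_mem LA t)%N else dispA t.
Proof.
elim: u => //= x u IHu; rewrite in_cons [LB == x]eq_sym.
by case: (x == LB) => //=; rewrite count_cat.
Qed.

Lemma invCA_cat u t :
  invCA (u ++ t) = (invCA u + invCA t + count_mem LC u * count_mem LA t)%N.
Proof.
elim: u => [|x u IHu] /=; first by rewrite addn0.
rewrite IHu count_cat mulnDl !addnA; case: (x == LC); rewrite ?mul1n ?mul0n; move: (count_mem LC u * _)%N => z; lia.
Qed.

Lemma dispA_nseq k t :
  dispA (nseq k LB ++ t) = if k is 0 then dispA t else count_mem LA t.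
Proof. by case: k => //= k; rewrite !letter_eq /= count_cat count_nseq /= letter_eq. Qed.

Lemma invCA_nseq k t : invCA (nseq k LB ++ t) = invCA t.
Proof. by elim: k => //= k ->; rewrite letter_eq. Qed.

Lemma count_nseqB k x : count_mem x (nseq k LB) = if x is LB then k else 0%N.
Proof. by rewrite count_nseq /= letter_eq; case: x; rewrite ?mul0n ?mul1n. Qed.

Definition wordE := (letter_eq, count_cat, count_nseqB, dispA_nseq, invCA_nseq).

(** Only the status of the letter moving right can change: it must be an A with no B before it, and
    it acquires one if it crosses some B, either y itself or one of the k in between. *)
Lemma dispA_up u x k y v : (rank x < rank y)%N ->
  dispA (u ++ y :: nseq k LB ++ x :: v) =
  (dispA (u ++ x :: nseq k LB ++ y :: v)
   + [&& x == LA, LB \notin u & (y == LB) || (0 < k)])%N.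
Proof.
move=> xy; rewrite !dispA_cat; case: (LB \in u).
  by rewrite andbF addn0 /= !count_cat /=; lia.
rewrite ?letter_eq; case: x xy; case: y => //= _; rewrite ?wordE;
  case: k => [|k]; rewrite /= ?wordE /= ?wordE; lia.
Qed.

(** The letters crossed are all B's, so no pair formed with a third letter is affected. *)
Lemma invCA_up u x k y v : (rank x < rank y)%N ->
  invCA (u ++ y :: nseq k LB ++ x :: v) =
  (invCA (u ++ x :: nseq k LB ++ y :: v) + (x == LA) && (y == LC))%N.
Proof.
move=> xy; rewrite !invCA_cat.
rewrite ?letter_eq; case: x xy; case: y => //= _;
  rewrite ?wordE /= ?wordE /= ?wordE; lia.
Qed.

Lemma dual_nseq k : dual (nseq k LB) = nseq k LB.
Proof. by rewrite /dual map_nseq rev_nseq. Qed.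

Lemma rank_flip x y : (rank (flip x) < rank (flip y))%N = (rank y < rank x)%N.
Proof. by case: x; case: y. Qed.

Lemma mem_dual l : (LB \in dual l) = (LB \in l).
Proof. by rewrite mem_rev -[LB in LHS]/(flip LB) mem_map //; apply: inv_inj flipK. Qed.

Lemma dispA_noB l : LB \notin l -> dispA l = 0%N.
Proof.
by elim: l => //= x l IHl; rewrite in_cons negb_or [LB == x]eq_sym => /andP[/negPf -> /IHl].
Qed.

Lemma dispA_le_count l : (dispA l <= count_mem LA l)%N.
Proof.
elim: l => //= y t IHt; case: ifP => _; first exact: leq_addl.
exact: leq_trans IHt (leq_addl _ _).
Qed.

Lemma dispC_up u x k y v : (rank x < rank y)%N ->
  dispC (u ++ y :: nseq k LB ++ x :: v) =
  (dispC (u ++ x :: nseq k LB ++ y :: v)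
   + [&& y == LC, LB \notin v & (x == LB) || (0 < k)])%N.
Proof.
move=> xy; rewrite /dispC !dual_pair dual_nseq dispA_up ?rank_flip //.
congr (_ + nat_of_bool _)%N; rewrite !letter_eq.
rewrite mem_dual.
by case: x xy; case: y.
Qed.

Lemma count_dual x l : count_mem x (dual l) = count_mem (flip x) l.
Proof.
rewrite /dual count_rev count_map; apply: eq_count => y /=.
by rewrite (can2_eq flipK flipK).
Qed.

Lemma invCA_dual l : invCA (dual l) = invCA l.
Proof.
elim: l => //= x l IHl; rewrite -cat1s dual_cat invCA_cat IHl.
by rewrite count_dual /= !letter_eq; case: x => //=; lia.
Qed.

Lemma dispA_le_size l : (dispA l <= size l)%N.
Proof. exact: leq_trans (dispA_le_count l) (count_size _ _). Qed.

Lemma dispC_le_size l : (dispC l <= size l)%N.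
Proof. by rewrite /dispC -(size_dual l) dispA_le_size. Qed.

Lemma invCA_le_size l : (invCA l <= size l ^ 2)%N.
Proof.
elim: l => //= x l IHl.
have H : ((if x == LC then count_mem LA l else 0) <= size l)%N.
  by case: ifP => // _; exact: count_size.
apply: leq_trans (leq_add H IHl) _.
by move: (size l) => n; rewrite -!mulnn; nia.
Qed.

Lemma size_seqswap l i j :
  (i < size l)%N -> (j < size l)%N -> size (seqswap l i j) = size l.
Proof. by move=> il jl; rewrite !size_set_nth; lia. Qed.

Lemma set_nth_size (d : letter) u x y v :
  set_nth d (u ++ x :: v) (size u) y = u ++ y :: v.
Proof. by elim: u => //= z u ->. Qed.

Lemma seqswap_cat u x m y v :
  seqswap (u ++ x :: m ++ y :: v) (size u) (size u + (size m).+1) =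
  u ++ y :: m ++ x :: v.
Proof.
have Ej z : u ++ z :: m ++ y :: v = (u ++ z :: m) ++ y :: v by rewrite -catA.
have -> : (size u + (size m).+1 = size (u ++ x :: m))%N by rewrite size_cat.
have En u' z v' : nth LA (u' ++ z :: v') (size u') = z by rewrite nth_cat ltnn subnn.
have El : nth LA (u ++ x :: m ++ y :: v) (size (u ++ x :: m)) = y by rewrite Ej En.
rewrite /seqswap El En set_nth_size.
have -> : size (u ++ x :: m) = size (u ++ y :: m) by rewrite !size_cat.
by rewrite Ej set_nth_size -catA.
Qed.

Lemma split_pair (l : seq letter) i j : (i < j < size l)%N ->
  exists u x m y v, [/\ l = u ++ x :: m ++ y :: v, i = size u
                      & j = (size u + (size m).+1)%N].
Proof.
case/andP=> ij jl.
exists (take i l), (nth LA l i), (take (j - i.+1) (drop i.+1 l)), (nth LA l j), (drop j.+1 l).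
have E : (j - i.+1 + i.+1)%N = j by lia.
split; last 2 first.
- by rewrite size_takel //; lia.
- by rewrite !size_takel ?size_drop; lia.
rewrite -[LHS](cat_take_drop i) (drop_nth LA) ?(ltn_trans ij) //; congr (_ ++ _ :: _).
rewrite -[LHS](cat_take_drop (j - i.+1)) drop_drop E.
by congr (_ ++ _); rewrite (drop_nth LA).
Qed.

Lemma all_isB_nseq m : all (pred1 LB) m -> m = nseq (size m) LB.
Proof. by move/all_pred1P. Qed.

(** * Swap rates, sums over pairs of positions, and duality *)

Section Rates.
Variable R : realType.
Implicit Types (c : nat -> nat -> R) (l : seq letter) (S : seq letter -> nat).

(* [c i j] is the probability that the pair (i, j), once chosen, gets swapped;
   the strengths enter the drift estimates only through these bounds. *)
Definition rates c l : Prop := forall u x m y v,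
  l = u ++ x :: m ++ y :: v ->
  let cij := c (size u) (size u + (size m).+1)%N in
  [/\ 0 <= cij,
      (x == y) || ~~ all (pred1 LB) m -> cij = 0,
      (rank x < rank y)%N ->
        cij <= (1 + 2 ^+ ((size m).+1 * (rank y - rank x)))^-1
    & (rank y < rank x)%N -> all (pred1 LB) m ->
        1 - (1 + 2 ^+ ((size m).+1 * (rank x - rank y)))^-1 <= cij].

Definition pair_sum n (f : nat -> nat -> R) : R :=
  \sum_(i < n) \sum_(j < n | (i < j)%N) f i j.

Definition up_rate S c l : R :=
  pair_sum (size l) (fun i j => c i j * (S l < S (seqswap l i j))%:R).
Definition down_rate S c l : R :=
  pair_sum (size l) (fun i j => c i j * (S (seqswap l i j) < S l)%:R).

Lemma le_pair_sum n (f g : nat -> nat -> R) :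
  (forall i j, (i < j < n)%N -> f i j <= g i j) -> pair_sum n f <= pair_sum n g.
Proof.
move=> fg; apply: ler_sum => i _; apply: ler_sum => j ij.
by apply: fg; rewrite ij ltn_ord.
Qed.

Lemma eq_pair_sum n (f g : nat -> nat -> R) :
  (forall i j, (i < j < n)%N -> f i j = g i j) -> pair_sum n f = pair_sum n g.
Proof.
move=> fg; apply: eq_bigr => i _; apply: eq_bigr => j ij.
by apply: fg; rewrite ij ltn_ord.
Qed.

Lemma pair_sum_ge_term n (f : nat -> nat -> R) i j :
  (forall i j, (i < j < n)%N -> 0 <= f i j) -> (i < j < n)%N -> f i j <= pair_sum n f.
Proof.
move=> f0 /andP[ij jn]; have i_n := ltn_trans ij jn.
rewrite /pair_sum (bigD1 (Ordinal i_n)) //= (bigD1 (Ordinal jn)) //= -addrA lerDl.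
rewrite addr_ge0 //; apply: sumr_ge0 => k Hk.
  by apply: f0; case/andP: Hk => -> _; rewrite ltn_ord.
by apply: sumr_ge0 => h kh; apply: f0; rewrite kh ltn_ord.
Qed.

(** Reflecting the positions exchanges the roles of the two indices and so preserves i < j. *)
Lemma pair_sum_rev n (f : nat -> nat -> R) :
  pair_sum n f = pair_sum n (fun i j => f (n - j.+1)%N (n - i.+1)%N).
Proof.
rewrite /pair_sum (exchange_big_dep xpredT) //= (reindex_inj rev_ord_inj) /=.
apply: eq_bigr => i _; rewrite (reindex_inj rev_ord_inj) /=.
by apply: eq_bigl => j; have := ltn_ord i; have := ltn_ord j; lia.
Qed.

Lemma rates_ge0 c l i j : rates c l -> (i < j < size l)%N -> 0 <= c i j.
Proof.
by move=> cl /split_pair[u [x [m [y [v [El -> ->]]]]]]; case: (cl _ _ _ _ _ El).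
Qed.

Lemma up_rate_ge0 S c l : rates c l -> 0 <= up_rate S c l.
Proof.
move=> cl; apply: sumr_ge0 => i _; apply: sumr_ge0 => j ij.
by rewrite mulr_ge0 // (rates_ge0 cl) // ij /=.
Qed.

Lemma down_rate_ge0 S c l : rates c l -> 0 <= down_rate S c l.
Proof.
move=> cl; apply: sumr_ge0 => i _; apply: sumr_ge0 => j ij.
by rewrite mulr_ge0 // (rates_ge0 cl) // ij /=.
Qed.

Definition dual_rate c n i j : R := c (n - j.+1)%N (n - i.+1)%N.

(** Duality keeps the gap between two positions; it reverses both their order and that of the ranks,
    so the same bounds apply. *)
Lemma rates_dual c l : rates c l -> rates (dual_rate c (size l)) (dual l).
Proof.
move=> cl u x m y v /(congr1 dual); rewrite dualK dual_pair => El.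
have := cl _ _ _ _ _ El; rewrite /= all_isB_dual !rank_flip (inj_eq (inv_inj flipK)) eq_sym.
rewrite /dual_rate El size_cat /= size_cat /= !size_dual.
have -> : (size v + (size m + (size u).+1).+1 - (size u + (size m).+1).+1 = size v)%N by lia.
have -> : (size v + (size m + (size u).+1).+1 - (size u).+1 = size v + (size m).+1)%N by lia.
have -> : (rank (flip x) - rank (flip y) = rank y - rank x)%N by case: (x); case: (y).
by have -> : (rank (flip y) - rank (flip x) = rank x - rank y)%N by case: (x); case: (y).
Qed.

Lemma seqswap_dual l i j : (i < j < size l)%N ->
  seqswap (dual l) (size l - j.+1) (size l - i.+1) = dual (seqswap l i j).
Proof.
move/split_pair => [u [x [m [y [v [-> -> ->]]]]]].
rewrite seqswap_cat !dual_pair -[RHS]seqswap_cat !size_dual !size_cat /= size_cat /=.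
by congr (seqswap _ _ _); lia.
Qed.

Lemma dual_up_rate c l :
  up_rate dispA (dual_rate c (size l)) (dual l) = up_rate dispC c l.
Proof.
rewrite /up_rate size_dual pair_sum_rev; apply: eq_pair_sum => i j Hij.
rewrite seqswap_dual // /dual_rate /dispC.
by congr (c _ _ * _); lia.
Qed.

Lemma dual_down_rate c l :
  down_rate dispA (dual_rate c (size l)) (dual l) = down_rate dispC c l.
Proof.
rewrite /down_rate size_dual pair_sum_rev; apply: eq_pair_sum => i j Hij.
rewrite seqswap_dual // /dual_rate /dispC.
by congr (c _ _ * _); lia.
Qed.

End Rates.

(** * Rates of change of the statistics *)

Section KeyFacts.
Variable R : realType.
Implicit Types (c : nat -> nat -> R) (l : seq letter) (S : seq letter -> nat).

(** Swaps away from the sorted order raise S by 0 or 1; read backwards, swaps towards it lower S by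
    0 or 1. *)
Definition up_stat S : Prop := forall u x k y v, (rank x < rank y)%N ->
  exists b : bool,
    S (u ++ y :: nseq k LB ++ x :: v) = (S (u ++ x :: nseq k LB ++ y :: v) + b)%N.

Lemma up_stat_dispA : up_stat dispA.
Proof. by move=> u x k y v xy; rewrite dispA_up //; eexists. Qed.
Lemma up_stat_dispC : up_stat dispC.
Proof. by move=> u x k y v xy; rewrite dispC_up //; eexists. Qed.
Lemma up_stat_invCA : up_stat invCA.
Proof. by move=> u x k y v xy; rewrite invCA_up //; eexists. Qed.

Lemma move_cases c l i j : rates c l -> (i < j < size l)%N -> c i j != 0 ->
  exists u x k y v, [/\ l = u ++ x :: nseq k LB ++ y :: v, i = size u,
    j = (size u + k.+1)%N, seqswap l i j = u ++ y :: nseq k LB ++ x :: v &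
    (rank x < rank y)%N /\ c i j <= (1 + 2 ^+ (k.+1 * (rank y - rank x)))^-1
    \/ (rank y < rank x)%N /\ 1 - (1 + 2 ^+ (k.+1 * (rank x - rank y)))^-1 <= c i j].
Proof.
move=> cl /split_pair[u [x [m [y [v [El -> ->]]]]]].
have [_ c0 cup cdown] := cl _ _ _ _ _ El.
case: (boolP (all _ m)) c0 cup cdown => [/all_isB_nseq Em|_]; last first.
  by rewrite orbT => -> //; rewrite eqxx.
rewrite orbF El seqswap_cat => c0 cup cdown nz.
exists u, x, (size m), y, v; split=> //; rewrite -?Em //.
case: (ltngtP (rank x) (rank y)) cup cdown => [_ cup _|_ _ cdown|E _ _].
- by left; split=> //; exact: cup.
- by right; split=> //; exact: cdown.
- by rewrite c0 ?eqxx ?letter_eq ?E ?eqxx in nz.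
Qed.

(** Without any B, [first_B] is the length of the word and [run_B] is 0. The default [LB] of
    [after_run] marks a run that ends the word, so that it is taken neither for an A nor for a C. *)
Definition first_B l := index LB l.
Definition run_B l := find (predC1 LB) (drop (first_B l) l).
Definition after_run l := nth LB (drop (first_B l) l) (run_B l).

Lemma find_nseqB k t : find (predC1 LB) (nseq k LB ++ t) = (k + find (predC1 LB) t)%N.
Proof. by elim: k => //= k ->; rewrite letter_eq. Qed.

Definition hop_sum g : R := \sum_(e < g) (1 + 2 ^+ e.+1)^-1.

(** The right-hand side is 4/5 of the least rate at which an A just after a run of g B's crosses it
    leftwards. *)
Lemma hop_sum_le g : hop_sum g <= 4 / 5 * (1 - (1 + 2 ^+ g)^-1).
Proof.
(* The constant 47/60 = 1/3 + 1/5 + 1/4 makes g = 2 an equality; later terms are below those of a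
   geometric series. The slack up to 4/5 = 48/60 serves the conclusion. *)
have S2 : forall g, hop_sum g.+2 <= 47 / 60 - (2 ^+ g.+2)^-1.
  elim=> [|n IHn].
    rewrite /hop_sum !big_ord_recr big_ord0 /= add0r expr1.
    have -> : 1 + 2 = 3 :> R by ring.
    have -> : 1 + 2 ^+ 2 = 5 :> R by ring.
    have -> : 2 ^+ 2 = 4 :> R by ring.
    lra.
  rewrite /hop_sum big_ord_recr /= -/(hop_sum n.+2).
  apply: le_trans (lerD IHn (lexx _)) _.
  have p0 : 0 < 2 ^+ n.+2 :> R by rewrite exprn_gt0.
  have : (1 + 2 ^+ n.+3)^-1 <= (2 ^+ n.+3)^-1 :> R.
    by rewrite lef_pV2 ?posrE ?addr_gt0 ?exprn_gt0 // lerDr.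
  rewrite [2 ^+ n.+3]exprS invfM; lra.
case: g => [|[|g]].
- rewrite /hop_sum big_ord0 expr0; have -> : 1 + 1 = 2 :> R by ring.
  lra.
- rewrite /hop_sum big_ord_recr big_ord0 /= add0r expr1.
  have -> : 1 + 2 = 3 :> R by ring.
  lra.
apply: le_trans (S2 g) _.
have p0 : 0 < 2 ^+ g.+2 :> R by rewrite exprn_gt0.
have : (1 + 2 ^+ g.+2)^-1 <= (2 ^+ g.+2)^-1 :> R.
  by rewrite lef_pV2 ?posrE ?addr_gt0 ?exprn_gt0 // lerDr.
have : 0 < (2 ^+ g.+2)^-1 :> R by rewrite invr_gt0.
lra.
Qed.

Lemma first_BE u t : LB \notin u -> first_B (u ++ LB :: t) = size u.
Proof. by move=> Bu; rewrite /first_B index_cat (negPf Bu) /= eqxx addn0. Qed.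

Lemma run_BE u t : LB \notin u -> run_B (u ++ LB :: t) = (find (predC1 LB) t).+1.
Proof.
by move=> Bu; rewrite /run_B first_BE // drop_size_cat //= letter_eq.
Qed.

Lemma after_runE u t : LB \notin u ->
  after_run (u ++ LB :: t) = nth LB t (find (predC1 LB) t).
Proof.
by move=> Bu; rewrite /after_run run_BE // first_BE // drop_size_cat.
Qed.

Lemma notin_rcons_A u : LB \notin u -> LB \notin rcons u LA.
Proof. by rewrite mem_rcons in_cons letter_eq. Qed.

(** Bounds the rate at which the A just before the first B goes to position j: a hop inside the run,
    or a jump with the C that ends it. The jump crosses at least one B, so its exponent is at least
    2 * 2 and its rate at most 1/17. *)
Let up_bound l j : R :=
  if (j < first_B l + run_B l)%N then (1 + 2 ^+ (j - first_B l).+1)^-1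
  else if j == (first_B l + run_B l)%N then (after_run l == LC)%:R / 17 else 0.

Lemma up_bound_ge0 l j : 0 <= up_bound l j.
Proof.
rewrite /up_bound; case: ifP => _; first by rewrite invr_ge0 addr_ge0 ?exprn_ge0.
by case: ifP => // _; rewrite divr_ge0.
Qed.

(** By [dispA_up] the moving A has no B before it and a B next to it on the right, hence it stands
    at [first_B l - 1]. *)
Lemma up_dispA_term c l i j : rates c l -> (i < j < size l)%N ->
  c i j * (dispA l < dispA (seqswap l i j))%:R
  <= (i.+1 == first_B l)%:R * ((first_B l <= j)%:R * up_bound l j).
Proof.
move=> cl ij.
have rhs0 : 0 <= (i.+1 == first_B l)%:R * ((first_B l <= j)%:R * up_bound l j).
  by rewrite !mulr_ge0 ?up_bound_ge0.
have [->|nz] := eqVneq (c i j) 0; first by rewrite mul0r.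
have [u [x [k [y [v [El Ei Ej -> [[xy cle]|[xy _]]]]]]]] := move_cases cl ij nz.
  2: by rewrite El (dispA_up _ _ _ xy) ltnNge leq_addr mulr0 -El.
rewrite {1}El (dispA_up _ _ _ xy) -[X in (X < _)%N]addn0 ltn_add2l.
case: (boolP [&& _, _ & _]) => [/and3P[/eqP xA Bu yk]|_]; last by rewrite mulr0.
have Bu' := notin_rcons_A Bu; rewrite mulr1; subst x.
case: y xy El cle yk => // _ El cle yk.
- have El' : l = rcons u LA ++ LB :: (nseq k LB ++ v).
    by rewrite El cat_rcons; congr (_ ++ _ :: _); elim: (k) => //= n ->.
  rewrite /up_bound El' !first_BE // run_BE // find_nseqB size_rcons Ei Ej eqxx mul1r.
  have -> : ((size u).+1 <= size u + k.+1)%N by lia.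
  rewrite mul1r ifT; last by rewrite addSn !addnS !ltnS leq_add2l leq_addr.
  have -> : ((size u + k.+1 - (size u).+1).+1 = k.+1 * (rank LB - rank LA))%N by rewrite /=; lia.
  by rewrite -Ej -Ei.
- case: k El Ej cle yk => [|k] El Ej cle yk; first by rewrite letter_eq in yk.
  have El' : l = rcons u LA ++ LB :: (nseq k LB ++ LC :: v) by rewrite El cat_rcons.
  have Ef : find (predC1 LB) (nseq k LB ++ LC :: v) = k.
    by rewrite find_nseqB /= letter_eq addn0.
  rewrite /up_bound El' !first_BE // run_BE // after_runE // Ef size_rcons Ei Ej eqxx mul1r.
  have -> : ((size u).+1 <= size u + k.+2)%N by lia.
  rewrite mul1r addSnnS ltnn eqxx nth_cat size_nseq ltnn subnn /= eqxx -Ej -Ei.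
  apply: le_trans cle _; rewrite mul1r lef_pV2 ?posrE ?addr_gt0 ?exprn_gt0 //.
  have -> : (k.+2 * (rank LC - rank LA) = 4 + k * 2)%N by rewrite /=; lia.
  rewrite exprD; have : 1 <= 2 ^+ (k * 2) :> R by rewrite exprn_ege1 // ler1n.
  have -> : 2 ^+ 4 = 16 :> R by ring.
  lra.
Qed.

Lemma up_dispA_le c l : rates c l ->
  up_rate dispA c l <= hop_sum (run_B l) + (after_run l == LC)%:R / 17.
Proof.
move=> cl; apply: le_trans (le_pair_sum (fun i j => @up_dispA_term c l i j cl)) _.
set n := size l; set f := first_B l.
(* The range of [j] is enlarged so that it can be split at the first B and at the end of its run:
   nothing before, [hop_sum] inside, the jump at the end, nothing beyond. *)
have Hn : (n <= f + (run_B l + n.+1))%N by lia.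
pose B := \sum_(j < n) (f <= j)%:R * up_bound l j.
have B0 : 0 <= B by apply: sumr_ge0 => j _; rewrite mulr_ge0 ?up_bound_ge0.
apply: (@le_trans _ _ (\sum_(i < n) (i.+1 == f)%:R * B)).
  apply: ler_sum => i _; rewrite -mulr_sumr ler_wpM2l // /B big_mkcond /=.
  apply: ler_sum => j _; case: ifP => // _.
  by rewrite mulr_ge0 ?up_bound_ge0.
rewrite -mulr_suml; apply: (@le_trans _ _ B).
  rewrite ler_piMl // -natr_sum lern1.
  case: (f) => [|f']; first by rewrite big1.
  under eq_bigr do rewrite eqSS.
  case: (ltnP f' n) => [fn|nf].
    rewrite (bigD1 (Ordinal fn)) //= eqxx big1 // => i; rewrite -val_eqE /=.
    by move=> /negPf ->.
  by rewrite big1 // => i _; have := ltn_ord i; case: eqP => //; lia.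
rewrite /B (big_ord_widen _ (fun j => (f <= j)%:R * up_bound l j) Hn).
apply: (@le_trans _ _ (\sum_(j < f + (run_B l + n.+1)) (f <= j)%:R * up_bound l j)).
  rewrite big_mkcond; apply: ler_sum => j _; case: ifP => // _.
  by rewrite mulr_ge0 ?up_bound_ge0.
rewrite big_split_ord /= big1 ?add0r; last first.
  by move=> j _; rewrite leqNgt ltn_ord mul0r.
rewrite big_split_ord /= [X in _ + X]big_ord_recl /= [X in _ + (_ + X)]big1 ?addr0.
  rewrite leq_addr mul1r /up_bound !addn0 ltnn eqxx lerD2r /hop_sum.
  apply: ler_sum => e _; rewrite leq_addr mul1r ifT; last by rewrite ltn_add2l.
  by rewrite addKn.
move=> e _; rewrite /up_bound /bump /= -/f ifF; last by lia.
by rewrite ifF ?mulr0 //; lia.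
Qed.

Lemma up_dispA_le1 c l : rates c l -> up_rate dispA c l <= 1.
Proof.
move=> /up_dispA_le H; apply: le_trans H _.
have := hop_sum_le (run_B l).
have : 0 <= (1 + 2 ^+ run_B l)^-1 :> R by rewrite invr_ge0 addr_ge0 ?exprn_ge0.
have : (after_run l == LC)%:R <= 1 :> R by rewrite lern1 leq_b1.
move: (hop_sum _) (_ ^-1) (_%:R) => h w b; lra.
Qed.

Lemma first_B_split l : LB \in l -> exists u t, l = u ++ LB :: t /\ LB \notin u.
Proof.
elim: l => //= x l IHl; rewrite in_cons; have [<-|nx] := eqVneq LB x.
  by exists [::], l.
move=> /IHl[u [t [-> Bu]]]; exists (x :: u), t; split=> //.
by rewrite in_cons negb_or nx.
Qed.

Lemma run_split t : exists k, t = nseq k LB \/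
  exists z v, z != LB /\ t = nseq k LB ++ z :: v.
Proof.
elim: t => [|x t [k [->|[z [v [zB ->]]]]]]; first by exists 0%N; left.
- have [->|xB] := eqVneq x LB; first by exists k.+1; left.
  by exists 0%N; right; exists x, (nseq k LB).
- have [->|xB] := eqVneq x LB; first by exists k.+1; right; exists z, v.
  by exists 0%N; right; exists x, (nseq k LB ++ z :: v).
Qed.

Lemma down_rate_ge_term S c l i j : rates c l -> (i < j < size l)%N ->
  (S (seqswap l i j) < S l)%N -> c i j <= down_rate S c l.
Proof.
move=> cl ij Sij.
have H0 i' j' : (i' < j' < size l)%N -> 0 <= c i' j' * (S (seqswap l i' j') < S l)%:R.
  by move=> Hij; rewrite mulr_ge0 // (rates_ge0 cl).
by have := pair_sum_ge_term H0 ij; rewrite Sij mulr1.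
Qed.

(** Cases on the end of the first run of B's. If the word ends there, no A is displaced; if a C
    follows, it precedes every displaced A; if an A follows, it crosses the run at rate at least 1 -
    1/3, and [hop_sum_le] compares the rates. *)
Lemma dispA_dichotomy c l : rates c l ->
  (dispA l <= invCA l)%N \/
  2 / 3 <= down_rate dispA c l /\ up_rate dispA c l <= 4 / 5 * down_rate dispA c l.
Proof.
move=> cl; case: (boolP (LB \in l)) => [/first_B_split[u [t [El Bu]]]|Bl]; last first.
  by left; rewrite dispA_noB.
have [k [Et|[z [v [zB Et]]]]] := run_split t.
  left; rewrite El dispA_cat (negPf Bu) /= eqxx Et count_nseqB //.
have cmB : count_mem LA (nseq k LB) = 0%N by rewrite count_nseqB.
case: z zB Et => [_ Et|/negP //|_ Et]; last first.
  left; rewrite El dispA_cat (negPf Bu) /= eqxx Et count_cat cmB /= invCA_cat /=.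
  by rewrite invCA_nseq /= !letter_eq /=; lia.
right; have := up_dispA_le cl.
have -> : run_B l = k.+1 by rewrite El run_BE // Et find_nseqB /= letter_eq /= addn0.
have -> : after_run l = LA.
  by rewrite El after_runE // Et find_nseqB /= letter_eq /= addn0 nth_cat size_nseq ltnn subnn.
rewrite letter_eq mul0r addr0 => Hup.
have El' : l = u ++ LB :: nseq k LB ++ LA :: v by rewrite El Et.
have [_ _ _] := cl _ _ _ _ _ El'; rewrite size_nseq => /(_ isT).
rewrite all_nseq /= eqxx orbT => /(_ isT) cge.
have Hij : (size u < size u + k.+1 < size l)%N.
  by rewrite El' size_cat /= size_cat size_nseq /=; lia.
have Hdown := @down_rate_ge_term dispA c l _ _ cl Hij.
have {}Hdown : c (size u) (size u + k.+1)%N <= down_rate dispA c l.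
  apply: Hdown; rewrite El' -[in X in (_ + X)%N](size_nseq k LB) seqswap_cat.
  by rewrite (@dispA_up u LA k LB v) // Bu !letter_eq /= addn1.
rewrite /= subn0 muln1 in cge.
have Hs := hop_sum_le k.+1.
have Hp : (1 + 2 ^+ k.+1)^-1 <= 3^-1 :> R.
  rewrite lef_pV2 ?posrE ?addr_gt0 ?exprn_gt0 // exprS.
  have : 1 <= 2 ^+ k :> R by rewrite exprn_ege1 // ler1n.
  by move: (2 ^+ k) => z; lra.
move: Hup Hdown cge Hs Hp.
move: (hop_sum _) (_ ^-1) (c _ _) (up_rate _ _ _) (down_rate _ _ _) => *; lra.
Qed.

Lemma up_dispC_le1 c l : rates c l -> up_rate dispC c l <= 1.
Proof. by rewrite -dual_up_rate => /rates_dual/up_dispA_le1. Qed.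

Lemma dispC_dichotomy c l : rates c l ->
  (dispC l <= invCA l)%N \/
  2 / 3 <= down_rate dispC c l /\ up_rate dispC c l <= 4 / 5 * down_rate dispC c l.
Proof.
by move=> /rates_dual/dispA_dichotomy; rewrite dual_up_rate dual_down_rate invCA_dual.
Qed.

End KeyFacts.

(** * Jumps and inversions between A's and C's *)

Section Jumps.
Variable R : realType.
Implicit Types (c : nat -> nat -> R) (l : seq letter) (S : seq letter -> nat).

Definition next_isC t : bool := nth LC t (find (predC1 LB) t) == LC.

Lemma next_isC_nseq k x t : x != LB -> next_isC (nseq k LB ++ x :: t) = (x == LC).
Proof.
by move=> xB; rewrite /next_isC find_nseqB /= xB addn0 nth_cat size_nseq ltnn subnn.
Qed.

Lemma next_isC_cons x t :
  next_isC (x :: t) = if x == LB then next_isC t else x == LC.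
Proof. by rewrite /next_isC /=; case: (x == LB). Qed.

Lemma drop_size_cons (u : seq letter) x t : drop (size u).+1 (u ++ x :: t) = t.
Proof. by rewrite -cat_rcons drop_size_cat ?size_rcons. Qed.

Lemma nth_size_cat (u : seq letter) x t : nth LA (u ++ x :: t) (size u) = x.
Proof. by rewrite nth_cat ltnn subnn. Qed.

Definition AC_left l i := (nth LA l i == LA) && next_isC (drop i.+1 l).
Definition CA_left l i := (nth LA l i == LC) && ~~ next_isC (drop i.+1 l).

(* Among A's and C's, steps A-to-C and C-to-A alternate, the end of the word
   counting as a C. *)
Lemma AC_left_count l :
  \sum_(i < size l) (AC_left l i)%:R <= 1 + \sum_(i < size l) (CA_left l i)%:R :> R.
Proof.
pose g i : R := (next_isC (drop i l))%:R.
suff : \sum_(i < size l) (AC_left l i)%:R - \sum_(i < size l) (CA_left l i)%:R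
       = g (size l) - g 0%N.
  have : g (size l) - g 0%N <= 1.
    by rewrite /g drop_size /next_isC /= eqxx; case: (_ == _); rewrite ?subrr ?subr0.
  by move=> H1 H2; rewrite -lerBlDr H2.
rewrite -sumrB -(big_mkord xpredT (fun i => (AC_left l i)%:R - (CA_left l i)%:R)).
rewrite -(telescope_sumr g (leq0n _)) !big_nat; apply: eq_bigr => i il.
have /andP[_ isl] := il; rewrite /g (drop_nth LA isl) next_isC_cons /AC_left /CA_left.
case: (nth LA l i); rewrite !letter_eq //=; case: (next_isC _); rewrite /= ?mulr1n ?mulr0n; ring.
Qed.

(** Only an A whose next letter other than B is a C can create an inversion, with that C alone, and
    the exponent is at least 2, whence 1/(1 + 4). *)
Lemma up_invCA_le c l : rates c l ->
  up_rate invCA c l <= 5^-1 * \sum_(i < size l) (AC_left l i)%:R.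
Proof.
move=> cl; rewrite mulr_sumr.
pose nx i := (i.+1 + find (predC1 LB) (drop i.+1 l))%N.
have rhs0 i j : 0 <= (j == nx i)%:R * (5^-1 * (AC_left l i)%:R) :> R.
  by rewrite !mulr_ge0 ?ler0n ?invr_ge0.
have term i j : (i < j < size l)%N ->
    c i j * (invCA l < invCA (seqswap l i j))%:R
    <= (j == nx i)%:R * (5^-1 * (AC_left l i)%:R).
  move=> Hij; have [->|nz] := eqVneq (c i j) 0; first by rewrite mul0r.
  have [u [x [k [y [v [El Ei Ej -> [[xy cle]|[xy _]]]]]]]] := move_cases cl Hij nz.
    2: by rewrite {1}El (invCA_up _ _ _ xy) ltnNge leq_addr mulr0.
  rewrite {1}El (invCA_up _ _ _ xy) -[X in (X < _)%N]addn0 ltn_add2l.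
  case: andP => [[/eqP xA /eqP yC]|_]; last by rewrite mulr0.
  subst x y; rewrite mulr1.
  have -> : (j == nx i) = true.
    rewrite /nx Ei Ej El drop_size_cons find_nseqB /= letter_eq /= addn0.
    by rewrite addSnnS eqxx.
  have -> : AC_left l i = true.
    by rewrite /AC_left Ei El nth_size_cat drop_size_cons next_isC_nseq !letter_eq.
  rewrite mul1r mulr1; apply: le_trans cle _.
  rewrite lef_pV2 ?posrE ?addr_gt0 ?exprn_gt0 //.
  have -> : (k.+1 * (rank LC - rank LA) = 2 + k * 2)%N by rewrite /=; lia.
  rewrite exprD; have : 1 <= 2 ^+ (k * 2) :> R by rewrite exprn_ege1 // ler1n.
  have -> : 2 ^+ 2 = 4 :> R by ring.
  by move: (2 ^+ _) => z; lra.
apply: (@le_trans _ _ (\sum_(i < size l) \sum_(j < size l)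
          (j == nx i :> nat)%:R * (5^-1 * (AC_left l i)%:R))).
  apply: ler_sum => i _; rewrite big_mkcond /=; apply: ler_sum => j _.
  by case: ifP => // ij; apply: term; rewrite ij /=.
apply: ler_sum => i _; rewrite -mulr_suml ler_piMl ?mulr_ge0 ?invr_ge0 //.
rewrite -natr_sum lern1; case: (ltnP (nx i) (size l)) => [nl|nl].
  rewrite (bigD1 (Ordinal nl)) //= eqxx big1 // => j; rewrite -val_eqE /=.
  by move=> /negPf ->.
by rewrite big1 // => j _; have := ltn_ord j; case: eqP => //; lia.
Qed.

(** Each step C-to-A provides a swap that removes an inversion, at rate at least 1 - 1/5. *)
Lemma down_invCA_ge c l : rates c l ->
  4 / 5 * \sum_(i < size l) (CA_left l i)%:R <= down_rate invCA c l.
Proof.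
move=> cl; rewrite mulr_sumr; apply: ler_sum => -[i il] _ /=.
have F0 (j : 'I_(size l)) : (i < j)%N -> 0 <= c i j * (invCA (seqswap l i j) < invCA l)%:R.
  by move=> ij; rewrite mulr_ge0 // (rates_ge0 cl) // ij /=.
case: (boolP (CA_left l i)) => [/andP[/eqP iC nC]|_]; last first.
  by rewrite mulr0; apply: sumr_ge0.
have El : l = take i l ++ LC :: drop i.+1 l by rewrite -iC -drop_nth // cat_take_drop.
have si : size (take i l) = i by rewrite size_takel // ltnW.
have [k [Et|[z [v [zB Et]]]]] := run_split (drop i.+1 l).
  (* If only B's follow, the default of [next_isC] counts the end as a C, against [nC]. *)
  by case/negP: nC; rewrite Et -[nseq _ _]cats0 /next_isC find_nseqB nth_cat size_nseq ltnNge leq_addr /= nth_default.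
rewrite Et next_isC_nseq // in nC.
have {nC zB} zA : z = LA by move: nC zB; rewrite !letter_eq; case: z {Et}.
rewrite {}zA {z} in Et.
have jl : (i + k.+1 < size l)%N.
  by have := congr1 size El; rewrite Et size_cat /= size_cat size_nseq si /= => ->; lia.
rewrite mulr1 (bigD1 (Ordinal jl)) /=; last by rewrite addnS ltnS leq_addr.
apply: ler_wpDr; first by apply: sumr_ge0 => j /andP[ij _]; exact: F0.
have El' : l = take i l ++ LC :: nseq k LB ++ LA :: v by rewrite -Et.
have [_ _ _] := cl _ _ _ _ _ El'; rewrite size_nseq si => /(_ isT).
rewrite all_nseq /= eqxx orbT => /(_ isT) cge.
have -> : seqswap l i (i + k.+1) = take i l ++ LA :: nseq k LB ++ LC :: v.
  by rewrite {1}El' -{2 3}si -[in X in (_ + X)%N](size_nseq k LB) seqswap_cat.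
have -> : (invCA (take i l ++ LA :: nseq k LB ++ LC :: v) < invCA l)%N = true.
  by rewrite {2}El' (@invCA_up _ LA k LC v) // !letter_eq /= addn1 ltnSn.
rewrite mulr1.
apply: le_trans cge; have -> : (k.+1 * (2 - 0) = 2 + k * 2)%N by lia.
have : (1 + 2 ^+ (2 + k * 2))^-1 <= 5^-1 :> R.
  rewrite lef_pV2 ?posrE ?addr_gt0 ?exprn_gt0 //.
  rewrite exprD; have : 1 <= 2 ^+ (k * 2) :> R by rewrite exprn_ege1 // ler1n.
  have -> : 2 ^+ 2 = 4 :> R by ring.
  by move: (2 ^+ _) => z; lra.
by move: (_ ^-1) => z; lra.
Qed.

Lemma invCA_next l : invCA l = 0%N -> (0 < count_mem LA l)%N -> ~~ next_isC l.
Proof.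
elim: l => // y l IHl /=; rewrite next_isC_cons.
case: y; rewrite !letter_eq //= ?add0n.
by move=> /eqP; rewrite addn_eq0 => /andP[/eqP -> _].
Qed.

(** The last C having an A after it works: no inversion lies to its right, so [invCA_next] finds an
    A next. *)
Lemma CA_left_exists l : (0 < invCA l)%N -> exists i : 'I_(size l), CA_left l i.
Proof.
elim: l => // x l IHl /=; case: (posnP (invCA l)) => [l0|/IHl[i Hi] _]; last first.
  by exists (lift ord0 i).
rewrite l0 addn0; case: (eqVneq x LC) => // -> lA; exists ord0.
by rewrite /CA_left /= drop0 eqxx /= invCA_next.
Qed.

(** At I = 0 nothing can decrease, so there is no step C-to-A and at most one step A-to-C. *)
Lemma up_invCA_ground c l : rates c l -> invCA l = 0%N -> up_rate invCA c l <= 5^-1.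
Proof.
move=> cl l0; have D0 : down_rate invCA c l = 0.
  by apply: big1 => i _; apply: big1 => j _; rewrite l0 mulr0.
have := up_invCA_le cl; have := down_invCA_ge cl; have := AC_left_count l.
rewrite D0; move: (\sum_(i < _) _) (\sum_(i < _) _) => a b; lra.
Qed.

(** With m >= 1 steps C-to-A there are at most m + 1 <= 2 m steps A-to-C: the rates are at most 2m/5
    upwards and at least 4m/5 downwards. *)
Lemma invCA_rates c l : rates c l -> (0 < invCA l)%N ->
  4 / 5 <= down_rate invCA c l /\ up_rate invCA c l <= 2^-1 * down_rate invCA c l.
Proof.
move=> cl /CA_left_exists[i Hi].
have H1 : 1 <= \sum_(i < size l) (CA_left l i)%:R :> R.
  by rewrite (bigD1 i) //= Hi lerDl sumr_ge0.
have := up_invCA_le cl; have := down_invCA_ge cl; have := AC_left_count l.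
move: H1; move: (\sum_(i < _) _) (\sum_(i < _) _) => a b; lra.
Qed.

End Jumps.

(** * Words of defect zero *)

Definition defect l := (dispA l + dispC l + invCA l)%N.

Lemma dispC_cons x l : dispC (x :: l) = (dispC l + ((x == LC) && (LB \in l)))%N.
Proof.
rewrite /dispC -cat1s dual_cat dispA_cat mem_dual.
case: (boolP (LB \in l)) => Bl; first by rewrite /= !letter_eq; case: x; rewrite /= ?addn0.
rewrite andbF addn0 [dispA (dual l)]dispA_noB ?mem_dual //.
by rewrite /dual /=; case: (_ == _).
Qed.

(** By induction on the head: after a B, p = 0 excludes A's; after a C, q = 0 excludes B's and I = 0
    excludes A's. *)
Lemma defect0_sorted l : defect l = 0%N -> sorted (relpre rank leq) l.
Proof.
rewrite /defect => Hl; rewrite sorted_pairwise; last by move=> x y z; apply: leq_trans.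
elim: l Hl => //= x l IHl; rewrite dispC_cons.
have memA : (LA \in l) = (0 < count_mem LA l)%N by rewrite -has_count has_pred1.
case: x; rewrite !letter_eq /=.
- by rewrite addn0 => /IHl ->; rewrite andbT; apply/allP.
- rewrite addn0 => H; rewrite IHl; last first.
    have := dispA_le_count l.
    by move: H {memA}; move: (count_mem LA l) => z; lia.
  rewrite andbT; apply/allP => -[] //; rewrite memA /=.
  by move: H {memA}; move: (count_mem LA l) => z; lia.
- move=> H; rewrite IHl ?andbT; last by lia.
  apply/allP => -[] //; rewrite ?memA /=; last by case: (LB \in l) H => //; lia.
  by move: H {memA}; move: (count_mem LA l) => z; lia.
Qed.

Lemma defect0_unique l1 l2 :
  defect l1 = 0%N -> defect l2 = 0%N -> perm_eq l1 l2 -> l1 = l2.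
Proof.
move=> /defect0_sorted s1 /defect0_sorted s2.
apply: sorted_eq s1 s2; first by move=> x y z; apply: leq_trans.
by move=> x y xy; apply/eqP; rewrite letter_eq eqn_leq.
Qed.

(** * The Lyapunov function *)

Section Lyapunov.
Variable R : realType.
Implicit Types (c : nat -> nat -> R) (l : seq letter) (S : seq letter -> nat).

Definition drift (phi : seq letter -> R) c l : R :=
  pair_sum (size l) (fun i j => c i j * (phi (seqswap l i j) - phi l)).

Lemma pair_sumD n (f g : nat -> nat -> R) :
  pair_sum n (fun i j => f i j + g i j) = pair_sum n f + pair_sum n g.
Proof.
by rewrite /pair_sum -big_split; apply: eq_bigr => i _; rewrite big_split.
Qed.

Lemma pair_sumZ n a (f : nat -> nat -> R) :
  pair_sum n (fun i j => a * f i j) = a * pair_sum n f.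
Proof.
by rewrite /pair_sum mulr_sumr; apply: eq_bigr => i _; rewrite mulr_sumr.
Qed.

Let r : R := 9 / 8.

Let r_ge1 : 1 <= r. Proof. by rewrite /r; lra. Qed.
Let r_ge0 n : 0 <= r ^+ n. Proof. by rewrite exprn_ge0 // (le_trans ler01). Qed.

(** A step up multiplies by 9/8, a gain of 1/8; a step down multiplies by 8/9, a loss of 1/9. *)
Lemma drift_exp S c l : up_stat S -> rates c l ->
  drift (fun l => r ^+ S l) c l =
  r ^+ S l * (8^-1 * up_rate S c l - 9^-1 * down_rate S c l).
Proof.
move=> upS cl; rewrite mulrBr !mulrA -mulNr.
rewrite /up_rate /down_rate -!pair_sumZ -pair_sumD; apply: eq_pair_sum => i j Hij.
have [->|nz] := eqVneq (c i j) 0; first by rewrite !mul0r !mulr0 addr0.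
have [u [x [k [y [v [El Ei Ej -> [[xy _]|[xy _]]]]]]]] := move_cases cl Hij nz.
  have [b Eb] := upS u x k y v xy; rewrite El Eb exprD.
  by case: b {Eb}; rewrite ?addn0 ?addn1 ?ltnn ?ltnSn ?ltnNge ?leqnSn /= /r;
     move: (c i j) (_ ^+ _) => C e; rewrite ?expr1 ?expr0; field.
have [b Eb] := upS u y k x v xy; rewrite El Eb exprD.
by case: b {Eb}; rewrite ?addn0 ?addn1 ?ltnn ?ltnSn ?ltnNge ?leqnSn /= /r;
   move: (c i j) (_ ^+ _) => C e; rewrite ?expr1 ?expr0; field.
Qed.

Let th : R := 16^-1.

(** One move shifts the three statistics in the same direction, by b <= 3 in total. Upwards the gain
    is th^d (1 - 16^-b) <= b th^d, downwards the loss is th^d (16^b - 1) >= 5 b th^d. *)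
Lemma drift_defect c l : rates c l ->
  drift (fun l => 1 - th ^+ defect l) c l <=
  th ^+ defect l * ((up_rate dispA c l + up_rate dispC c l + up_rate invCA c l)
    - 5 * (down_rate dispA c l + down_rate dispC c l + down_rate invCA c l)).
Proof.
move=> cl; rewrite -mulNr /up_rate /down_rate -!pair_sumD -!pair_sumZ -pair_sumD -pair_sumZ.
apply: le_pair_sum => i j Hij.
have [->|nz] := eqVneq (c i j) 0; first by rewrite !mul0r !addr0 !mulr0 addr0 mulr0.
have c0 : 0 <= c i j := rates_ge0 cl Hij.
rewrite -!mulrDr (mulrCA _ (c i j)) -mulrDr (mulrCA _ (c i j)) ler_wpM2l //.
have ltb n (b : bool) : (n < n + b)%N = b by case: b; rewrite ?addn0 ?addn1 ?ltnn ?ltnSn.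
have ltb' n (b : bool) : (n + b < n)%N = false by rewrite ltnNge leq_addr.
have [u [x [k [y [v [El Ei Ej -> [[xy _]|[xy _]]]]]]]] := move_cases cl Hij nz.
  have [b1 E1] := up_stat_dispA u k v xy; have [b2 E2] := up_stat_dispC u k v xy.
  have [b3 E3] := up_stat_invCA u k v xy.
  have -> : defect (u ++ y :: nseq k LB ++ x :: v) = (defect l + (b1 + b2 + b3))%N.
    by rewrite /defect E1 E2 E3 El; lia.
  rewrite E1 E2 E3 -El !ltb !ltb' exprD.
  have : 0 <= th ^+ defect l by rewrite exprn_ge0 // invr_ge0.
  move: (th ^+ defect l) => e e0 {E1 E2 E3}.
  by case: b1; case: b2; case: b3; rewrite /= ?addn0 ?add0n ?addn1 /= !(exprS, expr0) /th; lra.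
have [b1 E1] := up_stat_dispA u k v xy; have [b2 E2] := up_stat_dispC u k v xy.
have [b3 E3] := up_stat_invCA u k v xy.
set l' := u ++ y :: nseq k LB ++ x :: v in E1 E2 E3 *.
have -> : defect l = (defect l' + (b1 + b2 + b3))%N.
  by rewrite /defect El E1 E2 E3; lia.
rewrite El E1 E2 E3 !ltb !ltb' exprD.
have : 0 <= th ^+ defect l' by rewrite exprn_ge0 // invr_ge0.
move: (th ^+ defect l') => e e0 {E1 E2 E3}.
by case: b1; case: b2; case: b3; rewrite /= ?addn0 ?add0n ?addn1 /= !(exprS, expr0) /th; lra.
Qed.

(** If U <= 4/5 D, the bracket is at most -D/90 <= -1/135. Otherwise r^NA <= r^inv, and 1/8 + 1/135
    <= 1/7. *)
Lemma disp_drift_bound (NA inv : nat) (U D : R) : 0 <= D -> U <= 1 ->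
  (NA <= inv)%N \/ 2 / 3 <= D /\ U <= 4 / 5 * D ->
  r ^+ NA * (8^-1 * U - 9^-1 * D) <= - (r ^+ NA / 135) + r ^+ inv / 7.
Proof.
move=> D0 U1 [le|[D23 UD]].
  have : r ^+ NA <= r ^+ inv by rewrite ler_weXn2l.
  have : 0 <= r ^+ NA by [].
  move: (r ^+ NA) (r ^+ inv) => a b a0 ab.
  have : a * (8^-1 * U - 9^-1 * D) <= a * 8^-1 by rewrite ler_wpM2l //; lra.
  lra.
have : 0 <= r ^+ NA by [].
have : 0 <= r ^+ inv by [].
move: (r ^+ NA) (r ^+ inv) => a b b0 a0.
have : a * (8^-1 * U - 9^-1 * D) <= a * - 135^-1 by rewrite ler_wpM2l //; lra.
lra.
Qed.

(** For I > 0 the bracket is at most -(7/144)(4/5) <= -1/26; for I = 0 it is at most 1/40. *)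
Lemma inv_drift_bound c l : rates c l ->
  r ^+ invCA l * (8^-1 * up_rate invCA c l - 9^-1 * down_rate invCA c l)
  <= 1 - r ^+ invCA l / 26.
Proof.
move=> cl; have [l0|lpos] := posnP (invCA l).
  have := up_invCA_ground cl l0; have := down_rate_ge0 invCA cl.
  rewrite l0 expr0; move: (up_rate _ _ _) (down_rate _ _ _) => U D; lra.
have [D45 UD] := invCA_rates cl lpos.
have : 0 <= r ^+ invCA l by [].
move: D45 UD; move: (r ^+ _) (up_rate _ _ _) (down_rate _ _ _) => a U D D45 UD a0.
have : a * (8^-1 * U - 9^-1 * D) <= a * - 26^-1 by rewrite ler_wpM2l //; lra.
lra.
Qed.

(** The F of the overview. The weight 16 lets the gain 16/26 pay for the two errors 1/7 of
    [disp_drift_bound] and still leave 16/135. *)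
Definition energy l : R := r ^+ dispA l + r ^+ dispC l + 16 * r ^+ invCA l.

Lemma drift_energy c l : rates c l -> drift energy c l <= 16 - energy l / 135.
Proof.
move=> cl.
have -> : drift energy c l = drift (fun l => r ^+ dispA l) c l
    + drift (fun l => r ^+ dispC l) c l + 16 * drift (fun l => r ^+ invCA l) c l.
  rewrite /drift -pair_sumZ -!pair_sumD; apply: eq_pair_sum => i j _.
  by rewrite /energy; ring.
rewrite !drift_exp //; [|exact: up_stat_invCA|exact: up_stat_dispC|exact: up_stat_dispA].
have := inv_drift_bound cl.
have := disp_drift_bound (down_rate_ge0 dispA cl) (up_dispA_le1 cl) (dispA_dichotomy cl).
have := disp_drift_bound (down_rate_ge0 dispC cl) (up_dispC_le1 cl) (dispC_dichotomy cl).
have : 0 <= r ^+ invCA l by [].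
rewrite /energy.
move: (8^-1 * up_rate dispA c l - _) (8^-1 * up_rate dispC c l - _)
  (8^-1 * up_rate invCA c l - _) => x y z.
move: (r ^+ dispA l) (r ^+ dispC l) (r ^+ invCA l) => a b e; lra.
Qed.

(** If I > 0, the bracket of [drift_defect] is at most 2 - (9/2)(4/5) < -1. If I = 0, the upward
    rates total at most 2 + 1/5, and a nonzero p or q forces a downward rate of at least 2/3, giving
    11/5 - 10/3 < -1. *)
Lemma drift_defect_le c l : rates c l ->
  drift (fun l => 1 - th ^+ defect l) c l <= 3 /\
  ((0 < defect l)%N -> drift (fun l => 1 - th ^+ defect l) c l <= - th ^+ defect l).
Proof.
move=> cl; have Hd := drift_defect cl.
have th0 : 0 <= th ^+ defect l by rewrite exprn_ge0 // invr_ge0.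
have th1 : th ^+ defect l <= 1 by rewrite exprn_ile1 ?invr_ge0 // /th; lra.
have A0 := down_rate_ge0 dispA cl; have C0 := down_rate_ge0 dispC cl.
have A1 := up_dispA_le1 cl; have C1 := up_dispC_le1 cl.
have U0 S := up_rate_ge0 S cl.
have [l0|lpos] := posnP (invCA l); last first.
  have [D45 UD] := invCA_rates cl lpos.
  have H : drift (fun l => 1 - th ^+ defect l) c l <= th ^+ defect l * -1.
    by apply: le_trans Hd _; rewrite ler_wpM2l //; lra.
  by split=> [|_]; lra.
have := up_invCA_ground cl l0; have I0 := down_rate_ge0 invCA cl => I1.
split=> [|dpos].
  have : drift (fun l => 1 - th ^+ defect l) c l <= th ^+ defect l * 3.
    by apply: le_trans Hd _; rewrite ler_wpM2l //; lra.
  lra.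
suff H : drift (fun l => 1 - th ^+ defect l) c l <= th ^+ defect l * -1 by lra.
apply: le_trans Hd _; rewrite ler_wpM2l //.
have dA := dispA_dichotomy cl; have dC := dispC_dichotomy cl.
rewrite l0 in dA dC; case: dA => [A00|[DA UA]]; last by lra.
case: dC => [C00|[DC UC]]; last by lra.
by move: dpos; rewrite /defect l0; lia.
Qed.

(** The constants come before the rates and the word, hence are uniform in the length and the
    strengths. *)
Lemma exists_lyapunov : exists M eps : R, [/\ 0 <= M, 0 < eps <= 1 &
  forall c l, rates c l ->
    let W := fun l => energy l + M * (1 - th ^+ defect l) in
    drift W c l <= 16 + 3 * M /\
  ((0 < defect l)%N -> drift W c l <= - eps * W l)].
Proof.
(* From 4320 = 16 * 270 on, 16 - F/135 <= -F/270. Below it, each of p, q and I is at most [N0]. *)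
have [N0 HN0] : exists N0, 4320 <= r ^+ N0.
  have bern n : 1 + n%:R / 8 <= r ^+ n.
    elim: n => [|n IHn]; first by rewrite expr0; lra.
    rewrite exprS -natr1; apply: (@le_trans _ _ (r * (1 + n%:R / 8))).
      by have : 0 <= n%:R :> R by []; rewrite /r; move: (n%:R) => z; lra.
    by rewrite ler_wpM2l // (le_trans ler01).
  have H0 : 0 <= 8 * 4320 :> R by lra.
  exists (Num.bound (8 * 4320 : R)); have := archi_boundP H0; have := bern (Num.bound (8 * 4320 : R)).
  by move: (_%:R) (_ ^+ _) => x y; lra.
have th_gt0 n : 0 < th ^+ n by rewrite exprn_gt0 // /th invr_gt0.
(* With this [M] the correction cancels the constant 16 on every word of defect at most 3 N0. *)
have [M [M0 EM]] : exists M : R, 0 <= M /\ M * th ^+ (N0 + N0 + N0) = 16.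
  by exists (16 / th ^+ (N0 + N0 + N0)); rewrite divr_ge0 ?(ltW (th_gt0 _)) // divfK // gt_eqF.
(* A drift of -F/270 becomes -eps W because W <= (1 + M) F. *)
exists M, (270 * (1 + M))^-1; split=> //.
  by rewrite invr_gt0 invf_le1; lra.
move=> c l cl W.
have -> : drift W c l = drift energy c l + M * drift (fun l => 1 - th ^+ defect l) c l.
  rewrite /drift -pair_sumZ -pair_sumD; apply: eq_pair_sum => i j _.
  by rewrite /W; ring.
have [d3 dneg] := drift_defect_le cl; have dE := drift_energy cl.
have rge n : 1 <= r ^+ n by exact: exprn_ege1.
have E1 : 1 <= energy l.
  have := rge (dispA l); have := rge (dispC l); have := rge (invCA l).
  by rewrite /energy; lra.
split.
  by have := ler_wpM2l M0 d3; lra.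
move=> /dneg {}dneg; have Mneg := ler_wpM2l M0 dneg.
have HE : drift energy c l + M * drift (fun l => 1 - th ^+ defect l) c l <= - (energy l / 270).
  case: (lerP 4320 (energy l)) => [Elarge|Esmall].
    have : 0 <= M * th ^+ defect l by rewrite mulr_ge0 // ltW.
    lra.
  have small n : r ^+ n <= energy l -> (n <= N0)%N.
    move=> nE; rewrite leqNgt; apply/negP => Hn.
    have : r ^+ N0 <= r ^+ n by rewrite ler_weXn2l // ltnW.
    lra.
  have HA : (dispA l <= N0)%N.
    by apply: small; have := rge (dispC l); have := rge (invCA l); rewrite /energy; lra.
  have HC : (dispC l <= N0)%N.
    by apply: small; have := rge (dispA l); have := rge (invCA l); rewrite /energy; lra.
  have HI : (invCA l <= N0)%N.
    by apply: small; have := rge (dispC l); have := rge (dispA l);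
       have := rge (invCA l); rewrite /energy; lra.
  have : M * th ^+ (N0 + N0 + N0) <= M * th ^+ defect l.
    rewrite ler_wpM2l // ler_wiXn2l ?invr_ge0 //; first by rewrite /th; lra.
    by rewrite /defect !leq_add.
  rewrite EM => H16; clear - dE Mneg H16 E1; lra.
apply: le_trans HE _; rewrite mulNr lerN2 mulrC ler_pdivrMr; last by lra.
have W_le : W l <= energy l * (1 + M).
  have : M * (1 - th ^+ defect l) <= M * 1 by rewrite ler_wpM2l // lerBlDr lerDl ltW.
  have : M * 1 <= M * energy l by rewrite ler_wpM2l.
  rewrite /W; lra.
apply: le_trans W_le _; lra.
Qed.

End Lyapunov.

(** * The chain on words *)

Section Words.
Variables (R : realType) (s : letter -> R) (n : nat).
Implicit Types (w v : word n) (i j k : 'I_n).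
Hypothesis s_gt0 : forall x, 0 < s x.
Hypothesis s_rank : forall x y, (rank x < rank y)%N -> 2 ^+ (rank y - rank x) * s x <= s y.

Definition word_seq w : seq letter := [seq w i | i <- enum 'I_n].

Lemma size_word_seq w : size (word_seq w) = n.
Proof. by rewrite size_map size_enum_ord. Qed.

Lemma nth_word_seq w i : nth LA (word_seq w) i = w i.
Proof. by rewrite (nth_map i) ?size_enum_ord // nth_ord_enum. Qed.

Lemma word_seq_inj : injective word_seq.
Proof. by move=> w v E; apply/ffunP => i; rewrite -!nth_word_seq E. Qed.

Lemma word_seq_swap w i j : (i < j)%N ->
  word_seq (swap w i j) = seqswap (word_seq w) i j.
Proof.
move=> ij; apply: (@eq_from_nth _ LA).
  by rewrite size_seqswap !size_word_seq.
suff H (k : 'I_n) : nth LA (word_seq (swap w i j)) k = nth LA (seqswap (word_seq w) i j) k.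
  by move=> k; rewrite size_word_seq => kn; exact: (H (Ordinal kn)).
rewrite nth_word_seq ffunE /seqswap !nth_set_nth /= !nth_set_nth /= !nth_word_seq !val_eqE.
by case: tpermP => [->|->|/eqP/negPf -> /eqP/negPf ->]; rewrite ?eqxx //;
   case: eqP => // ->.
Qed.

Definition B_between w i j := [forall k : 'I_n, (i < k < j)%N ==> (w k == LB)].

(** One formula for jumps and hops: the word is resampled between w and its swap according to the
    stationary law. *)
Definition swap_prob w i j : R :=
  if (w i != w j) && B_between w i j
  then s (w i) ^+ (j - i) / (s (w i) ^+ (j - i) + s (w j) ^+ (j - i)) else 0.

Lemma s_ltE x y : (s x < s y) = (rank x < rank y)%N.
Proof.
have mono x' y' : (rank x' < rank y')%N -> s x' < s y'.
  move=> xy; apply: lt_le_trans (s_rank xy).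
  by rewrite ltr_pMl // exprn_egt1 ?ltr1n // -lt0n subn_gt0.
case: ltngtP => [/mono //|/mono/ltW yx|E].
  by apply/negbTE; rewrite -leNgt.
have -> : x = y by apply/eqP; rewrite letter_eq E.
by rewrite ltxx.
Qed.

Lemma is_hopE p w i j : (i < j)%N -> is_hop p w i j =
  ((w i == LB) && (w j == p) || (w i == p) && (w j == LB)) && B_between w i j.
Proof.
move=> ij; rewrite /is_hop.
have -> : [forall k : 'I_n, (i <= k < j)%N ==> (w k == LB)]
          = (w i == LB) && B_between w i j.
  apply/forallP/andP => [H|[wi /forallP H] k].
    split; first by have := H i; rewrite leqnn ij.
    apply/forallP => k; apply/implyP => /andP[ik kj].
    by have := H k; rewrite (ltnW ik) kj.
  apply/implyP => /andP[]; rewrite leq_eqVlt => /orP[/eqP/val_inj <- //|ik kj].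
  by have := H k; rewrite ik kj.
have -> : [forall k : 'I_n, (i < k <= j)%N ==> (w k == LB)]
          = (w j == LB) && B_between w i j.
  apply/forallP/andP => [H|[wj /forallP H] k].
    split; first by have := H j; rewrite leqnn ij.
    apply/forallP => k; apply/implyP => /andP[ik kj].
    by have := H k; rewrite (ltnW kj) ik.
  apply/implyP => /andP[ik]; rewrite leq_eqVlt => /orP[/eqP/val_inj -> //|kj].
  by have := H k; rewrite ik kj.
by case: (B_between w i j); rewrite ?andbF ?andbT.
Qed.

Lemma pair_kernelE w v i j : (i < j)%N ->
  pair_kernel s i j w v = (1 - swap_prob w i j) * (v == w)%:R
                          + swap_prob w i j * (v == swap w i j)%:R.
Proof.
move=> ij; rewrite /pair_kernel /move_odds /is_jump -/(B_between w i j) !is_hopE //.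
rewrite /swap_prob /put_increasing /put_decreasing !s_ltE !letter_eq.
case: (B_between w i j); last by rewrite !andbF; ring.
have p0 x : 0 < s x ^+ (j - i) by rewrite exprn_gt0.
have gtz x : s x ^+ (j - i) != 0 by rewrite gt_eqF.
have gtz2 x y : s x ^+ (j - i) + s y ^+ (j - i) != 0 by rewrite gt_eqF ?addr_gt0.
case: (w i); case: (w j) => /=; rewrite ?expr_div_n; try by ring.
all: by field; rewrite ?gtz ?gtz2.
Qed.

Lemma swap_prob_ge0 w i j : 0 <= swap_prob w i j.
Proof.
rewrite /swap_prob; case: ifP => // _.
by rewrite divr_ge0 ?addr_ge0 // exprn_ge0 // ltW.
Qed.

Lemma swap_prob_le1 w i j : swap_prob w i j <= 1.
Proof.
rewrite /swap_prob; case: ifP => // _.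
by rewrite ler_pdivrMr ?mul1r ?lerDl ?addr_gt0 ?exprn_gt0 // exprn_ge0 // ltW.
Qed.

Lemma swapK w i j : swap (swap w i j) i j = w.
Proof. by apply/ffunP => k; rewrite !ffunE tpermK. Qed.

Lemma swapL w i j : swap w i j i = w j. Proof. by rewrite ffunE tpermL. Qed.
Lemma swapR w i j : swap w i j j = w i. Proof. by rewrite ffunE tpermR. Qed.

Lemma B_between_swap w i j : B_between (swap w i j) i j = B_between w i j.
Proof.
apply: eq_forallb => k; case: (boolP (i < k < j)%N) => //= /andP[ik kj].
by rewrite ffunE tpermD // -val_eqE /= neq_ltn ?ik ?kj ?orbT.
Qed.

Lemma swap_prob_swap w i j : swap_prob w i j != 0 ->
  swap_prob w i j + swap_prob (swap w i j) i j = 1.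
Proof.
rewrite /swap_prob B_between_swap swapL swapR [w j == w i]eq_sym.
case: ifP => [_ _|_]; last by rewrite eqxx.
by rewrite [X in _ + _ / X]addrC -mulrDl divff // gt_eqF // addr_gt0 // exprn_gt0.
Qed.

Lemma weight_swap w i j : (i < j)%N ->
  weight s w * s (w i) ^+ (j - i) = weight s (swap w i j) * s (w j) ^+ (j - i).
Proof.
move=> ij; have ji : j != i by rewrite -val_eqE /= gtn_eqF.
rewrite /weight (bigD1 i) //= (bigD1 j) //= [in RHS](bigD1 i) //= [in RHS](bigD1 j) //=.
rewrite swapL swapR.
have -> : \prod_(k < n | (k != i) && (k != j)) s (swap w i j k) ^+ k.+1
        = \prod_(k < n | (k != i) && (k != j)) s (w k) ^+ k.+1.
  by apply: eq_bigr => k /andP[ki kj]; rewrite ffunE tpermD // eq_sym.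
have -> : j.+1 = (i.+1 + (j - i))%N by rewrite addSn subnKC // ltnW.
by rewrite !exprD; ring.
Qed.

Lemma swap_prob_balance w i j : (i < j)%N ->
  weight s w * swap_prob w i j
  = weight s (swap w i j) * swap_prob (swap w i j) i j.
Proof.
move=> ij; rewrite /swap_prob B_between_swap swapL swapR [w j == w i]eq_sym.
case: ifP => [_|_]; last by rewrite !mulr0.
by rewrite !mulrA weight_swap // [X in _ = _ / X]addrC.
Qed.

(** The indexing by naturals that [rates] asks for, with value 0 outside the word. *)
Definition nat_rate w (i j : nat) : R :=
  match insub i : option 'I_n, insub j : option 'I_n with
  | Some i', Some j' => swap_prob w i' j'
  | _, _ => 0
  end.

Lemma nat_rateE w i j : nat_rate w i j = swap_prob w i j.
Proof. by rewrite /nat_rate !valK. Qed.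

Lemma up_prob_le x y d : (rank x < rank y)%N ->
  s x ^+ d / (s x ^+ d + s y ^+ d) <= (1 + 2 ^+ (d * (rank y - rank x)))^-1.
Proof.
move=> xy; have p0 z : 0 < s z ^+ d by rewrite exprn_gt0.
rewrite ler_pdivrMr ?addr_gt0 // mulrC ler_pdivlMr; last first.
  by rewrite addr_gt0 // exprn_gt0.
rewrite mulrDr mulr1 lerD2l mulnC exprM -exprMn.
rewrite lerXn2r ?nnegrE ?mulr_ge0 ?exprn_ge0 ?(ltW (s_gt0 _)) //.
by rewrite mulrC s_rank.
Qed.

Lemma rates_word w : rates (nat_rate w) (word_seq w).
Proof.
move=> u x m y v El /=.
have sz := size_word_seq w; rewrite El size_cat /= size_cat /= in sz.
have un : (size u < n)%N by lia.
have vn : (size u + (size m).+1 < n)%N by lia.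
set i := Ordinal un; set j := Ordinal vn.
rewrite -[X in nat_rate w _ X]/(nat_of_ord j) -[X in nat_rate w X _]/(nat_of_ord i) nat_rateE.
have wi : w i = x by rewrite -nth_word_seq El nth_cat /= ltnn subnn.
have wj : w j = y.
  rewrite -nth_word_seq El nth_cat /= ltnNge leq_addr /= addKn /=.
  by rewrite nth_cat ltnn subnn.
have Bm : B_between w i j = all (pred1 LB) m.
  apply/forallP/(all_nthP LA) => [H t tm|H k].
    have kn : (size u + t.+1 < n)%N by lia.
    have wk : w (Ordinal kn) = nth LA m t.
      by rewrite -nth_word_seq El /= nth_cat ltnNge leq_addr /= addKn /= nth_cat tm.
    have := H (Ordinal kn); rewrite wk => /implyP; apply.
    by rewrite /= ltn_add2l ltnS tm andbT addnS ltnS leq_addr.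
  apply/implyP => /= /andP[ik kj]; rewrite -nth_word_seq El nth_cat ltnNge (ltnW ik) /=.
  have [t Et] : exists t, (k - size u = t.+1)%N by exists (k - size u).-1; lia.
  rewrite Et /= nth_cat; have tm : (t < size m)%N by lia.
  by rewrite tm; have := H t tm.
rewrite /swap_prob Bm wi wj /=.
have -> : (size u + (size m).+1 - size u = (size m).+1)%N by rewrite addKn.
split.
- by have := swap_prob_ge0 w i j; rewrite /swap_prob Bm wi wj /= addKn.
- by case: (x == y) => //= /negPf ->.
- move=> xy; case: ifP => _; last by rewrite invr_ge0 addr_ge0 ?exprn_ge0.
  exact: up_prob_le.
- move=> yx ->; rewrite letter_eq gtn_eqF //=.
  have := up_prob_le (size m).+1 yx.
  have p0 z : 0 < s z ^+ (size m).+1 by rewrite exprn_gt0.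
  (* A downward swap is complementary to the upward swap of the exchanged letters, so [up_prob_le]
     bounds it too. *)
  have -> : s x ^+ (size m).+1 / (s x ^+ (size m).+1 + s y ^+ (size m).+1)
    = 1 - s y ^+ (size m).+1 / (s y ^+ (size m).+1 + s x ^+ (size m).+1).
    by field; rewrite !gt_eqF ?addr_gt0.
  by rewrite lerD2l lerN2.
Qed.

Lemma sum_pairs1 : \sum_(i < n) \sum_(j < n | (i < j)%N) 1 = 'C(n, 2)%:R :> R.
Proof.
rewrite (exchange_big_dep xpredT) //= -bin2_sum natr_sum big_mkord.
apply: eq_bigr => j _; rewrite sumr_const; congr (1 *+ _).
pose f := widen_ord (ltnW (ltn_ord j)).
have finj : injective f by move=> x y /(congr1 val) /= /val_inj.
rewrite -[RHS]card_ord -[RHS]cardsT -(card_imset _ finj).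
apply: eq_card => i; rewrite unfold_in; apply/idP/imsetP => [ij|[k _ ->]].
  by exists (Ordinal (ij : (i < j)%N)) => //; apply: val_inj.
exact: (ltn_ord k).
Qed.

End Words.

(** Jensen for the square: the variance under the uniform law is nonnegative. *)
Lemma sqr_mean_le (R : realType) (I : finType) (Q : pred I) (m : R) (f : I -> R) :
  0 < m -> \sum_(i | Q i) 1 = m ->
  (m^-1 * \sum_(i | Q i) f i) ^+ 2 <= m^-1 * \sum_(i | Q i) f i ^+ 2.
Proof.
move=> m0 Em; set t := m^-1 * _.
have : 0 <= \sum_(i | Q i) (f i - t) ^+ 2 by apply: sumr_ge0 => i _; exact: sqr_ge0.
have E i : (f i - t) ^+ 2 = f i ^+ 2 + (1 * t ^+ 2 - 2 * t * f i) by ring.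
rewrite (eq_bigr _ (fun i _ => E i)) big_split /= sumrB -mulr_suml -mulr_sumr Em.
have -> : \sum_(i | Q i) f i = m * t by rewrite /t mulrA divff ?mul1r // gt_eqF.
move=> H; rewrite -(ler_pM2l m0) (mulVKf (lt0r_neq0 m0)); lra.
Qed.

(** * Reversibility and positivity of the chain on words of given content *)

Section Chain.
Variables (R : realType) (s : letter -> R) (a b c : nat).
Local Notation n := (a + b + c)%N.
Hypothesis s_gt0 : forall x, 0 < s x.
Hypothesis s_rank : forall x y, (rank x < rank y)%N -> 2 ^+ (rank y - rank x) * s x <= s y.
Implicit Types (x y : Omega a b c) (i j : 'I_n) (g : Omega a b c -> R).

Lemma has_content_swap (w : word n) i j :
  has_content a b c (swap w i j) = has_content a b c w.
Proof.
have E L : #|[set k | swap w i j k == L]| = #|[set k | w k == L]|.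
  rewrite -[RHS](card_preimset _ (@perm_inj _ (tperm i j))).
  by apply: eq_card => k; rewrite !inE ffunE.
by rewrite /has_content !E.
Qed.

Lemma omega_swap_proof x i j : has_content a b c (swap (val x) i j).
Proof. by rewrite has_content_swap; exact: valP x. Qed.

Definition omega_swap x i j : Omega a b c := 
  exist (fun w => has_content a b c w) _ (omega_swap_proof x i j).

Lemma omega_swapK x i j : omega_swap (omega_swap x i j) i j = x.
Proof. by apply: val_inj; rewrite /= swapK. Qed.

Definition pair_avg i j g x : R :=
  \sum_y pair_kernel s i j (val x) (val y) * g y.

Let p i j x : R := swap_prob s (val x) i j.

Lemma pair_avgE i j g x : (i < j)%N ->
  pair_avg i j g x = g x + p i j x * (g (omega_swap x i j) - g x).
Proof.
move=> ij; rewrite /pair_avg.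
have E y : pair_kernel s i j (val x) (val y) * g y =
    (1 - p i j x) * ((y == x)%:R * g y) + p i j x * ((y == omega_swap x i j)%:R * g y).
  by rewrite pair_kernelE // -!val_eqE /= /p; ring.
have delta z : \sum_y (y == z)%:R * g y = g z.
  rewrite (bigD1 z) //= eqxx mul1r big1 ?addr0 // => y /negPf ->.
  by rewrite mul0r.
by rewrite (eq_bigr _ (fun y _ => E y)) big_split /= -!mulr_sumr !delta; ring.
Qed.

Hypothesis n_ge2 : (2 <= n)%N.
Let N : R := 'C(n, 2)%:R.

Let N_gt0 : 0 < N. Proof. by rewrite /N ltr0n bin_gt0. Qed.

Let P := @chainX R s a b c.

Lemma avg_chainE g x :
  avg P g x = N^-1 * \sum_(i < n) \sum_(j < n | (i < j)%N) pair_avg i j g x.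
Proof.
rewrite /avg /P /chainX /word_kernel ltnNge n_ge2 /= mulr_sumr.
under eq_bigr do rewrite mulrAC mulr_suml.
rewrite -mulr_suml exchange_big mulrC mulr_sumr; apply: eq_bigr => i _ /=.
congr (_ * _); under eq_bigr do rewrite mulr_suml.
by rewrite exchange_big.
Qed.

Lemma avg_chain_drift g x :
  avg P g x = g x + N^-1 * \sum_(i < n) \sum_(j < n | (i < j)%N)
                      p i j x * (g (omega_swap x i j) - g x).
Proof.
rewrite avg_chainE.
have -> : \sum_(i < n) \sum_(j < n | (i < j)%N) pair_avg i j g x
  = N * g x + \sum_(i < n) \sum_(j < n | (i < j)%N) p i j x * (g (omega_swap x i j) - g x).
  rewrite /N -sum_pairs1 mulr_suml -big_split; apply: eq_bigr => i _ /=.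
  rewrite mulr_suml -big_split; apply: eq_bigr => j ij /=.
  by rewrite mul1r pair_avgE.
by rewrite mulrDr mulrA mulVf ?mul1r // gt_eqF.
Qed.

Lemma chain_ge0 x y : 0 <= P x y.
Proof.
rewrite /P /chainX /word_kernel ltnNge n_ge2 /= divr_ge0 ?(ltW N_gt0) //.
apply: sumr_ge0 => i _; apply: sumr_ge0 => j ij; rewrite pair_kernelE //.
by rewrite addr_ge0 // mulr_ge0 ?subr_ge0 ?swap_prob_ge0 ?swap_prob_le1.
Qed.

Lemma chain_sum x : \sum_y P x y = 1.
Proof.
have := avg_chain_drift (fun=> 1) x; rewrite /avg; under eq_bigr do rewrite mulr1.
move=> ->; rewrite big1 ?mulr0 ?addr0 // => i _; rewrite big1 // => j _.
by rewrite subrr mulr0.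
Qed.

Lemma weight_gt0 (w : word n) : 0 < weight s w.
Proof. by apply: prodr_gt0 => i _; rewrite exprn_gt0. Qed.

Lemma pair_kernel_rev i j x y : (i < j)%N ->
  weight s (val x) * pair_kernel s i j (val x) (val y)
  = weight s (val y) * pair_kernel s i j (val y) (val x).
Proof.
move=> ij; rewrite !pair_kernelE // !mulrDr.
congr (_ + _); first by have [->|] := eqVneq (val x) (val y); rewrite // !mulr0.
rewrite !mulrA swap_prob_balance //.
have [->|ne] := eqVneq (val y) (swap (val x) i j); first by rewrite swapK eqxx.
by have [E|] := eqVneq (val x) _; rewrite ?mulr0 //; rewrite E swapK eqxx in ne.
Qed.

Let Z : R := \sum_(y : Omega a b c) weight s (val y).
Variable o : Omega a b c.

Let Z_gt0 : 0 < Z.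
Proof.
rewrite /Z (bigD1 o) //= ltr_pwDl ?weight_gt0 // sumr_ge0 // => x _.
by rewrite ltW ?weight_gt0.
Qed.

Let pi := @stationary R s a b c.

Lemma stationary_gt0 x : 0 < pi x.
Proof. by rewrite divr_gt0 ?weight_gt0. Qed.

Lemma stationary_sum : \sum_x pi x = 1.
Proof. by rewrite -mulr_suml divff // gt_eqF. Qed.

Lemma chain_rev x y : pi x * P x y = pi y * P y x.
Proof.
rewrite /pi /stationary /P /chainX /word_kernel ltnNge n_ge2 /=.
rewrite mulrAC [RHS]mulrAC; congr (_ / _); rewrite !mulrA; congr (_ / _).
rewrite !mulr_sumr; apply: eq_bigr => i _; rewrite !mulr_sumr.
by apply: eq_bigr => j ij; exact: pair_kernel_rev.
Qed.

(* Each pair kernel is a conditional expectation. *)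
Lemma pair_avg_proj i j g : (i < j)%N ->
  \sum_x pi x * pair_avg i j g x ^+ 2 = \sum_x pi x * (g x * pair_avg i j g x).
Proof.
move=> ij; apply/eqP; rewrite -subr_eq0 -sumrB.
set S := \sum_x _; suff : S + S = 0 by move=> H; apply/eqP; lra.
have sinv : injective (fun x => omega_swap x i j).
  by apply: inv_inj => x; exact: omega_swapK.
rewrite {2}/S (reindex_inj sinv) /= -big_split big1 // => x _ /=.
rewrite !pair_avgE // omega_swapK.
have bal : pi x * p i j x = pi (omega_swap x i j) * p i j (omega_swap x i j).
  by rewrite /pi /stationary !(mulrAC _ (Z^-1)) swap_prob_balance.
have [p0|pn0] := eqVneq (p i j x) 0.
  have p0' : p i j (omega_swap x i j) = 0.
    apply/eqP; move/eqP: bal; rewrite p0 mulr0 eq_sym mulf_eq0.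
    by rewrite gt_eqF ?stationary_gt0.
  by rewrite p0 p0'; ring.
have one : p i j (omega_swap x i j) = 1 - p i j x.
  by rewrite -(swap_prob_swap s_gt0 pn0) [swap_prob _ (val x) _ _ + _]addrC addrK.
rewrite one in bal *.
set q := p i j x in bal *; set u := g x; set v := g _.
set px := pi x in bal *; set py := pi _ in bal *.
have -> : px * (u + q * (v - u)) ^+ 2 - px * (u * (u + q * (v - u)))
  = (px * q) * ((v - u) * (u + q * (v - u))) by ring.
by rewrite bal; ring.
Qed.

(** Convexity of the square moves the average over pairs outside; [pair_avg_proj] then treats each
    pair. *)
Lemma chain_psd g : \sum_x pi x * avg P g x ^+ 2 <= \sum_x pi x * (g x * avg P g x).
Proof.
have Npairs : \sum_(k : 'I_n * 'I_n | (k.1 < k.2)%N) 1 = N.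
  by rewrite /N -sum_pairs1 pair_big_dep.
apply: (@le_trans _ _ (N^-1 * \sum_(k : 'I_n * 'I_n | (k.1 < k.2)%N)
    \sum_x pi x * pair_avg k.1 k.2 g x ^+ 2)).
  rewrite exchange_big mulr_sumr; apply: ler_sum => x _.
  rewrite -mulr_sumr [leRHS]mulrCA ler_pM2l ?stationary_gt0 // avg_chainE pair_big_dep /=.
  exact: (sqr_mean_le (fun k => pair_avg k.1 k.2 g x) N_gt0 Npairs).
rewrite (eq_bigr _ (fun k kk => pair_avg_proj g kk)) exchange_big mulr_sumr.
apply: ler_sum => x _; rewrite avg_chainE pair_big_dep /= -mulr_sumr -mulr_sumr.
by rewrite mulrCA [_^-1 * (g x * _)]mulrCA.
Qed.

End Chain.

(** * Assembly of the mixing bound *)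

Lemma energy_ge1 (R : realType) l : 1 <= energy R l.
Proof.
have r1 n : 1 <= (9 / 8) ^+ n :> R by apply: exprn_ege1; lra.
have := r1 (dispA l); have := r1 (dispC l); have := r1 (invCA l).
by rewrite /energy; lra.
Qed.

Lemma energy_le (R : realType) l : (0 < size l)%N ->
  energy R l <= 18 * 2 ^+ (size l ^ 2).
Proof.
move=> l0; have le2 n : (n <= size l ^ 2)%N -> (9 / 8) ^+ n <= 2 ^+ (size l ^ 2) :> R.
  move=> nl; apply: (@le_trans _ _ (2 ^+ n)).
    by apply: lerXn2r; rewrite ?nnegrE; lra.
  by rewrite ler_weXn2l // ler1n.
have sl : (size l <= size l ^ 2)%N by rewrite -{1}[size l]expn1 leq_pexp2l.
have := le2 _ (leq_trans (dispA_le_size l) sl).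
have := le2 _ (leq_trans (dispC_le_size l) sl).
have := le2 _ (invCA_le_size l).
by rewrite /energy; lra.
Qed.

Lemma drift_word (R : realType) (s : letter -> R) n (W : seq letter -> R) (w : word n) :
  drift W (nat_rate s w) (word_seq w) =
  \sum_(i < n) \sum_(j < n | (i < j)%N)
    swap_prob s w i j * (W (word_seq (swap w i j)) - W (word_seq w)).
Proof.
rewrite /drift size_word_seq; apply: eq_bigr => i _; apply: eq_bigr => j ij.
by rewrite nat_rateE word_seq_swap.
Qed.

Lemma word_seq_perm a b c (x y : Omega a b c) :
  perm_eq (word_seq (val x)) (word_seq (val y)).
Proof.
have cnt (z : Omega a b c) L :
    count_mem L (word_seq (val z)) = #|[set i | val z i == L]|.
  rewrite /word_seq count_map -sum1_count big_enum_cond /= -sum1_card.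
  by apply: eq_bigl => i; rewrite !inE.
apply/allP => L _ /=; rewrite !cnt.
have /and3P[/eqP xA /eqP xB /eqP xC] := valP x.
have /and3P[/eqP yA /eqP yB /eqP yC] := valP y.
by case: L; rewrite ?xA ?xB ?xC ?yA ?yB ?yC.
Qed.

Lemma omega_defect0 a b c (x y : Omega a b c) :
  defect (word_seq (val x)) = 0%N -> defect (word_seq (val y)) = 0%N -> x = y.
Proof.
move=> x0 y0; apply/val_inj/word_seq_inj.
exact: defect0_unique x0 y0 (word_seq_perm x y).
Qed.

Lemma omega_small a b c (x y : Omega a b c) : (a + b + c < 2)%N -> x = y.
Proof.
have small l : (size l < 2)%N -> defect l = 0%N.
  by case: l => [|z [|]] //= _; case: z; rewrite /defect /dispC /= !letter_eq.
by move=> n2; apply: omega_defect0; apply: small; rewrite size_word_seq.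
Qed.

Lemma mixed_subsingleton (R : realType) (T : finType) (P : T -> T -> R) (pi : T -> R) :
  (forall x y : T, x = y) -> (forall x, pi x = 1) -> mixed P pi 0.
Proof.
move=> sub pi1; apply: bigmax_le => [|x _]; first by lra.
rewrite /tv_dist big1 ?mul0r; first by lra.
by move=> y _; rewrite (sub x y) /= eqxx pi1 subrr normr0.
Qed.

(** The comparison inside [mixed] is boolean, so a least time can be extracted. *)
Lemma is_mixing_time_exists (R : realType) (T : finType) (P : T -> T -> R) (pi : T -> R) u :
  mixed P pi u -> exists2 t, is_mixing_time P pi t & (t <= u)%N.
Proof.
move=> mu; have ex : exists t, \big[Num.max/0]_x tv_dist (kernel_pow P t x) pi <= 1 / 4.
  by exists u.
case: (ex_minnP ex) => t mt tmin; exists t; last exact: tmin.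
by split=> // v /tmin.
Qed.

Lemma exists_nat_pow2 (R : realType) (x : R) : exists k, x <= 2 ^+ k.
Proof.
have two n : n%:R <= 2 ^+ n :> R by rewrite -natrX ler_nat ltnW // ltn_expl.
exists (Num.bound `|x|); apply: le_trans (two _).
exact: le_trans (ler_norm x) (ltW (archi_boundP (normr_ge0 x))).
Qed.

Lemma inv16_exp_bounds (R : realType) n : 0 <= (16^-1 : R) ^+ n <= 1.
Proof.
have [t0 t1] : 0 <= 16^-1 :> R /\ 16^-1 <= 1 :> R by split; lra.
move: (16^-1 : R) t0 t1 => t t0 t1; rewrite exprn_ge0 //=.
by rewrite exprn_ile1.
Qed.

Lemma time_budget E n k1 k2 : (1 < n)%N ->
  (E * n ^ 2 * (k1 + 4) + E * n ^ 2 * (k2 + n ^ 2 + 3) <= E * (k1 + k2 + 8) * n ^ 4)%N.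
Proof.
move=> n2; have -> : (n ^ 4 = n ^ 2 * n ^ 2)%N by rewrite -expnD.
have : (0 < n ^ 2)%N by rewrite expn_gt0 (ltn_trans _ n2).
move: (n ^ 2)%N => m m1; rewrite -mulnDr -!mulnA leq_mul2l; apply/orP; right.
rewrite mulnCA leq_mul2l; apply/orP; right.
have : (k1 + k2 + 7 <= (k1 + k2 + 7) * m)%N by rewrite leq_pmulr.
by rewrite (_ : (k1 + k2 + 8) * m = (k1 + k2 + 7) * m + m)%N; lia.
Qed.

Theorem theorem6 (R : realType) :
  exists K : R, 0 < K /\
    forall (a b c : nat) (s : letter -> R),
      0 < s LA -> s LA < s LB -> s LB < s LC ->
      s LA / s LB <= 1 / 2 -> s LB / s LC <= 1 / 2 ->
      exists t : nat,
        is_mixing_time (@chainX R s a b c) (@stationary R s a b c) t /\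
        t%:R <= K * (a + b + c)%N%:R ^+ 4.
Proof.
have [M [eps [M0 /andP[eps0 eps1] HW]]] := exists_lyapunov R.
(* Powers of 2 above the ground constant, the scale of W and 1/eps, all fixed before n and s. *)
have [k1 Hk1] := exists_nat_pow2 ((16 + 3 * M) / eps + 18).
have [k2 Hk2] := exists_nat_pow2 (18 + M).
have [k3 Hk3] := exists_nat_pow2 (eps^-1).
pose E := (2 ^ k3)%N.
exists (E * (k1 + k2 + 8))%:R; split.
  by rewrite ltr0n muln_gt0 expn_gt0 addn_gt0 orbT.
move=> a b c s sA sAB sBC rAB rBC; set n := (a + b + c)%N.
have sB : 0 < s LB by apply: lt_trans sAB.
have sC : 0 < s LC by apply: lt_trans sBC.
have s_gt0 x : 0 < s x by case: x.
have AB : 2 * s LA <= s LB by move: rAB; rewrite ler_pdivrMr //; lra.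
have BC : 2 * s LB <= s LC by move: rBC; rewrite ler_pdivrMr //; lra.
have s_rank x y : (rank x < rank y)%N -> 2 ^+ (rank y - rank x) * s x <= s y.
  by case: x; case: y => //= _; rewrite ?subn0 ?subSS ?expr1 ?expr2 //; lra.
have [n2|n2] := ltnP n 2.
  have [|t mt t0] := @is_mixing_time_exists R (Omega a b c)
      (@chainX R s a b c) (@stationary R s a b c) 0.
    apply: mixed_subsingleton => [x y|x]; first exact: omega_small.
    rewrite -(stationary_sum s_gt0 x) (bigD1 x) //= big1 ?addr0 // => y.
    by rewrite (omega_small y x n2) eqxx.
  exists t; split=> //; move: t0; rewrite leqn0 => /eqP ->.
  by rewrite mulr_ge0 // exprn_ge0.
(* The time of [mixed_drift] for q = E n^2 and exponents k1 and k2 + n^2, the latter because log W =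
   O(n^2). *)
pose u := (E * n ^ 2 * (k1 + 4) + E * n ^ 2 * (k2 + n ^ 2 + 3))%N.
have [|t mt tu] := @is_mixing_time_exists R (Omega a b c)
    (@chainX R s a b c) (@stationary R s a b c) u; last first.
  exists t; split=> //; rewrite -natrX -natrM ler_nat (leq_trans tu) //.
  exact: time_budget.
(* A word [o] serves for the positivity of the normalising sum and for the arg min; over an empty
   type the maximum is 0. *)
case: (pickP (@predT (Omega a b c))) => [o _|none]; last first.
  by apply: bigmax_le => [|x _]; [lra|have := none x].
pose V (x : Omega a b c) := defect (word_seq (val x)).
pose Wseq l := energy R l + M * (1 - 16^-1 ^+ defect l).
pose W (x : Omega a b c) : R := Wseq (word_seq (val x)).
(* Minimality stands in for a construction of the sorted word: if V vanishes at x, it vanishes at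
   [x0] too, and [omega_defect0] identifies them. *)
pose x0 := [arg min_(x < o) V x]%N.
have x0min x : (V x0 <= V x)%N by rewrite /x0; case: arg_minnP => // y _; apply.
have Vpos x : x != x0 -> (0 < V x)%N.
  move=> nx; rewrite lt0n; apply: contra_neq nx => Vx.
  by apply: omega_defect0 => //; apply/eqP; rewrite -leqn0 -[X in (_ <= X)%N]Vx.
pose N : R := 'C(n, 2)%:R.
have N0 : 0 < N by rewrite ltr0n bin_gt0.
have N1 : 1 <= N by rewrite ler1n bin_gt0.
have th x := inv16_exp_bounds R (V x).
have W1 x : 1 <= W x.
  have := energy_ge1 R (word_seq (val x)); have /andP[th0 th1] := th x.
  have : 0 <= M * (1 - 16^-1 ^+ V x) by rewrite mulr_ge0 // subr_ge0.
  by rewrite /W /Wseq -/(V x); move=> H1 H2; clear - H1 H2; lra.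
have avgW x : avg (@chainX R s a b c) W x = W x + N^-1 *
    drift Wseq (nat_rate s (val x)) (word_seq (val x)).
  by rewrite (avg_chain_drift s_gt0 s_rank n2) drift_word.
have drift0 x : drift Wseq (nat_rate s (val x)) (word_seq (val x)) <= 16 + 3 * M /\
    ((0 < V x)%N ->
     drift Wseq (nat_rate s (val x)) (word_seq (val x)) <= - eps * W x).
  by apply: HW; exact: rates_word.
have W_drift x : (0 < V x)%N ->
    avg (@chainX R s a b c) W x <= (1 - eps / N) * W x.
  move=> Vx; rewrite avgW mulrBl mul1r lerD2l.
  have [_ /(_ Vx) H] := drift0 x.
  have -> : - (eps / N * W x) = N^-1 * (- eps * W x) by ring.
  by rewrite ler_pM2l // invr_gt0.
(* At a word of defect 0, W = 18 and the drift is at most 16 + 3 M; gamma cc covers (16 + 3 M)/N +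
   18 gamma. *)
pose cc := (16 + 3 * M) / eps + 18.
have gcc : eps / N * cc = N^-1 * (16 + 3 * M) + eps / N * 18.
  by rewrite /cc; field; rewrite !gt_eqF.
have g0 : 0 < eps / N by rewrite divr_gt0.
apply: (@mixed_drift R _ _ _ _ _ _ _ _ W x0 (eps / N) cc).
- exact: chain_ge0 s_gt0 s_rank n2.
- exact: chain_sum s_gt0 s_rank n2.
- exact: stationary_gt0 s_gt0 o.
- exact: stationary_sum s_gt0 o.
- exact: chain_rev s_gt0 s_rank n2.
- exact: g0.
- by rewrite ler_pdivrMr // mul1r (le_trans eps1).
- exact: W1.
- by move=> x /Vpos/W_drift.
(* Should the minimal defect be positive, the drift inequality holds at [x0] as elsewhere. *)
- have [/eqP V00|] := boolP (V x0 == 0%N); last first.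
    rewrite -lt0n => Vx0.
    apply: le_trans (W_drift _ Vx0) _; rewrite lerDl mulr_ge0 ?(ltW g0) //.
    by rewrite /cc addr_ge0 // divr_ge0 ?(ltW eps0) // addr_ge0 // mulr_ge0.
  have W18 : W x0 = 18.
    have : (dispA (word_seq (val x0)) + dispC (word_seq (val x0)) + invCA (word_seq (val x0)) = 0)%N.
      exact: V00.
    move/eqP; rewrite !addn_eq0 => /andP[/andP[/eqP dA /eqP dC] /eqP dI].
    by rewrite /W /Wseq -/(V x0) V00 /energy dA dC dI !expr0; ring.
  rewrite avgW gcc W18; have [H _] := drift0 x0.
  have H' : N^-1 * drift Wseq (nat_rate s (val x0)) (word_seq (val x0))
      <= N^-1 * (16 + 3 * M).
    by rewrite ler_pM2l // invr_gt0.
  by move: H'; move: (N^-1 * drift _ _ _) (N^-1 * (16 + 3 * M)) (eps / N) => A1 A2 A3; lra.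
- exact: chain_psd s_gt0 s_rank n2 o.
(* q gamma >= 1, since E >= 1/eps and 'C(n, 2) <= n^2. *)
- rewrite mulrA ler_pdivlMr // mul1r.
  have CN : N <= (n ^ 2)%:R.
    rewrite ler_nat bin2 -mulnn; apply: leq_trans (half_leq (leq_mul (leqnn n) (leq_pred n))) _.
    by rewrite -divn2 leq_div.
  have Eeps : 1 <= E%:R * eps.
    by rewrite /E natrX -ler_pdivrMr // mul1r.
  rewrite natrM mulrAC; apply: le_trans CN _.
  by rewrite ler_peMl.
- exact: Hk1.
- move=> x; have sn : (0 < size (word_seq (val x)))%N by rewrite size_word_seq (ltn_trans _ n2).
  have := energy_le R sn; rewrite size_word_seq -/n => He.
  have /andP[th0 th1] := th x.
  have HM : M * (1 - 16^-1 ^+ V x) <= M * 2 ^+ (n ^ 2).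
    rewrite ler_wpM2l // (@le_trans _ _ 1) ?exprn_ege1 ?ler1n // lerBlDr lerDl //.
  apply: (@le_trans _ _ ((18 + M) * 2 ^+ (n ^ 2))); first by rewrite /W /Wseq mulrDl lerD.
  by rewrite exprD ler_wpM2r // exprn_ge0.
Qed.
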